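(* Assume that: (i) the function $\phi$ is bounded; (ii) the function $\psi(x):=\mathbb{E}[\phi(f(x,\Theta))]$ is globally Lipschitz continuous on $\mathbb{R}^d$; (iii) the function $\vartheta(x):=\mathrm{Var}(\phi(f(x,\Theta)))$ is continuous on $\mathbb{R}^d$; (iv) $\operatorname{supp}(\mu_X)\subset\operatorname{supp}(\mu_{X'})$; (v) there exists an integer $m_0\ge1$ such that $\mathbb{E}\left[\min_{1\le j\le m_0}|X'_j|\right]<+\infty$; (vi) $\mathbb{E}[|X|^q]<+\infty$ for some $q\in[1,+\infty)$, where $X\sim\mu_X$. Then $$\mathbb{E}\left[\left|\widehat{\mathrm{QI}}_{m,n}^{(1)}-\mathrm{QI}\right|\right]\xrightarrow[m,n\to+\infty]{}0$$ if and only if $$\forall x\in\mathcal{A}_X,\qquad\vartheta(x)=0,$$ where $\mathcal{A}_X:=\{x\in\mathbb{R}^d:\mu_X(\{x\})>0\}$ is the set of atoms of $\mu_X$.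
   Context: $|\cdot|$ is a fixed norm on $\mathbb{R}^d$ (not necessarily Euclidean). $\mathbf{\Theta}$ is a measurable space, $f:\mathbb{R}^d\times\mathbf{\Theta}\to\mathbb{R}^e$ and $\phi:\mathbb{R}^e\to\mathbb{R}$ are measurable. $\mu_X,\mu_{X'}$ are probability measures on $\mathbb{R}^d$ and $\mu_\Theta$ a probability measure on $\mathbf{\Theta}$. $X\sim\mu_X$ and $\Theta\sim\mu_\Theta$ are independent, $Y=f(X,\Theta)$, and $\mathrm{QI}=\mathbb{E}[\phi(Y)]$. $(X_i)_{i\ge1}$ are i.i.d. with law $\mu_X$, $(X'_j)_{j\ge1}$ are i.i.d. with law $\mu_{X'}$, $(\Theta_j)_{j\ge1}$ are i.i.d. with law $\mu_\Theta$, and these three sequences are independent; $Y'_j=f(X'_j,\Theta_j)$. With $B(x,r)=\{x':|x-x'|\le r\}$, $\operatorname{supp}(\nu)=\{x\in\mathbb{R}^d:\forall r>0,\ \nu(B(x,r))>0\}$. The $1$-NN estimator is $$\widehat{\mathrm{QI}}_{m,n}^{(1)}=\frac1m\sum_{j=1}^m w^{(1)}_j\phi(Y'_j),\qquad w^{(1)}_j:=\frac mn\sum_{i=1}^n\mathbf{1}_{\{j=j^{(1)}(X_i)\}},$$ where $j^{(1)}(x)$ is the lowest index $j\in\{1,\dots,m\}$ minimizing $|x-X'_j|$. *)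

(* Defs.v *)
From HB Require Import structures.
From mathcomp Require Import all_boot all_order all_algebra.
From mathcomp Require Import all_classical all_reals all_analysis.

Set Implicit Arguments.
Unset Strict Implicit.
Unset Printing Implicit Defensive.

Import Order.TTheory GRing.Theory Num.Theory.
Import numFieldNormedType.Exports.

Local Open Scope classical_set_scope.
Local Open Scope ring_scope.

Section borel_matrix.
Context (R : realType) (m n : nat).

(* Borel sigma-algebra of the usual topology on matrices; in particular on
   R^d, represented by 'rV[R]_d. *)
HB.instance Definition _ :=
  @isMeasurable.Build (sigma_display (@open 'M[R]_(m, n))) 'M[R]_(m, n)
    <<s @open 'M[R]_(m, n) >>
    (@sigma_algebra0 _ setT _) (@sigma_algebraC _ _)
    (@sigma_algebra_bigcup _ setT _).

End borel_matrix.

Section norms.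
Context (R : realType) (d : nat).

Record is_norm (N : 'rV[R]_d -> R) : Prop := IsNorm {
  is_norm_ge0 : forall x, 0 <= N x ;
  is_norm_eq0 : forall x, N x = 0 -> x = 0 ;
  is_normZ : forall (a : R) x, N (a *: x) = `|a| * N x ;
  is_norm_triangle : forall x y, N (x + y) <= N x + N y }.

Definition closed_ball_of (N : 'rV[R]_d -> R) (x : 'rV[R]_d) (r : R) :
  set 'rV[R]_d := [set x' | N (x - x') <= r].

Definition supp (N : 'rV[R]_d -> R) (nu : probability 'rV[R]_d R) :
  set 'rV[R]_d :=
  [set x | forall r : R, 0 < r -> (0 < nu (closed_ball_of N x r))%E].

Definition atoms (nu : probability 'rV[R]_d R) : set 'rV[R]_d :=
  [set x | (0 < nu [set x])%E].

Definition lipschitz_wrt (N : 'rV[R]_d -> R) (g : 'rV[R]_d -> R) : Prop :=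
  exists L : R, forall x y, `|g x - g y| <= L * N (x - y).

End norms.

Section independence.
Context (dO : measure_display) (Omega : measurableType dO) (R : realType)
  (P : probability Omega R).

Definition independent_systems (I : eqType) (F : I -> set (set Omega)) : Prop :=
  forall (s : seq I) (A : I -> set Omega), uniq s ->
    (forall i, i \in s -> F i (A i)) ->
    P (\bigcap_(i in [set` s]) A i) = (\prod_(i <- s) P (A i))%E.

Context (dT : measure_display) (T : measurableType dT).

Definition sigma_rv (X : Omega -> T) : set (set Omega) :=
  preimage_set_system setT X measurable.

Definition sigma_seq (X : nat -> Omega -> T) : set (set Omega) :=
  <<s \bigcup_i sigma_rv (X i) >>.

Definition has_law (X : {RV P >-> T}) (mu : probability T R) : Prop :=
  forall A, measurable A -> distribution P X A = mu A.

Definition iid (X : nat -> {RV P >-> T}) (mu : probability T R) : Prop :=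
  (forall i, has_law (X i) mu) /\
  independent_systems (fun i : nat => sigma_rv (X i)).

End independence.

(* Sequences are indexed from 0: the paper's x_j, 1 <= j <= m, is x (j - 1). *)
Section estimator.
Context (R : realType) (d : nat) (N : 'rV[R]_d -> R).

(* lowest index j < m minimizing N (x - xs j) (the scan of iota 0 m returns
   the first such j) *)
Definition nn_index (m : nat) (xs : nat -> 'rV[R]_d) (x : 'rV[R]_d) : nat :=
  find (fun j => [forall k : 'I_m, N (x - xs j) <= N (x - xs k)]) (iota 0 m).

Definition nn_weight (m n : nat) (xs xs' : nat -> 'rV[R]_d) (j : nat) : R :=
  m%:R / n%:R * \sum_(i < n) (j == nn_index m xs' (xs i))%:R.

(* zs j is the value of phi at the j-th output Y'_j *)
Definition nn_estimator (m n : nat) (xs xs' : nat -> 'rV[R]_d)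
    (zs : nat -> R) : R :=
  m%:R^-1 * \sum_(j < m) nn_weight m n xs xs' j * zs j.

End estimator.

(* Main.v *)
(* With J_i the index of the nearest neighbour of X_i among X'_1, ..., X'_m and
   g(x,t) = phi(f(x,t)), the estimator is the average over i <= n of
   g(X'_(J_i), Theta_(J_i)).  Its error splits into three averages,
     A: g(X'_(J_i), Theta_(J_i)) - psi(X'_(J_i)),
     B: psi(X'_(J_i)) - psi(X_i),
     C: psi(X_i) - QI.
   C tends to 0 in L^2 by orthogonality.  Every point x of supp mu_X' is almost
   surely the limit of its nearest neighbours, so B tends to 0 in L^1 by bounded
   convergence, because psi is bounded and Lipschitz.  Freezing all the variables
   but one Theta_j shows that the terms of A with distinct J_i are orthogonal, so
   that E[A^2] equals, up to O(1/n),
     I_m = E[1{J_1 = J_2} vartheta(X'_(J_1))].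
   As m grows, J_1 and J_2 separate unless X_1 = X_2, hence
     I_m -> E[1{X_1 = X_2} vartheta(X_1)] = int mu_X{x} vartheta(x) dmu_X(x),
   which vanishes iff vartheta is 0 on the atoms.  As everything is bounded,
   E|A| -> 0 iff E[A^2] -> 0. *)
Require Import Defs.
From HB Require Import structures.
From mathcomp Require Import all_boot all_order all_algebra.
From mathcomp Require Import all_classical all_reals all_analysis.
From mathcomp Require Import measurable_realfun lra ring.

Set Implicit Arguments.
Unset Strict Implicit.
Unset Printing Implicit Defensive.

Import Order.TTheory GRing.Theory Num.Theory.
Import numFieldNormedType.Exports.

Local Open Scope classical_set_scope.
Local Open Scope ring_scope.

(** * Integrals of bounded measurable functions *)

Section bounded_measurable.
Context {R : realType}.

(** The working class of integrands: stable under algebraic operations and integrable for every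
    probability, so that integrals are computed in [R] without separate integrability conditions. *)
Definition bmeas d (T : measurableType d) (h : T -> R) : Prop :=
  measurable_fun setT h /\ exists K : R, forall x, `|h x| <= K.

Context d (T : measurableType d).
Implicit Types h g : T -> R.

Lemma bmeas_measurable h : bmeas h -> measurable_fun setT h.
Proof. by case. Qed.

Lemma bmeas_cst (c : R) : bmeas (cst c : T -> R).
Proof. by split; [exact: measurable_cst|exists `|c|]. Qed.

Lemma bmeasN h : bmeas h -> bmeas (fun x => - h x).
Proof.
move=> [mh [K hK]]; split; first exact: measurableT_comp.
by exists K => x; rewrite normrN.
Qed.

Lemma bmeasD h g : bmeas h -> bmeas g -> bmeas (fun x => h x + g x).
Proof.
move=> [mh [K hK]] [mg [L gL]]; split; first exact: measurable_funD.
by exists (K + L) => x; rewrite (le_trans (ler_normD _ _))// lerD.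
Qed.

Lemma bmeasB h g : bmeas h -> bmeas g -> bmeas (fun x => h x - g x).
Proof. by move=> bh bg; apply: bmeasD => //; exact: bmeasN. Qed.

Lemma bmeasM h g : bmeas h -> bmeas g -> bmeas (fun x => h x * g x).
Proof.
move=> [mh [K hK]] [mg [L gL]]; split; first exact: measurable_funM.
by exists (K * L) => x; rewrite normrM ler_pM.
Qed.

Lemma bmeas_norm h : bmeas h -> bmeas (fun x => `|h x|).
Proof.
move=> [mh [K hK]]; split; first exact: measurableT_comp.
by exists K => x; rewrite normr_id.
Qed.

Lemma bmeas_sum (I : Type) (r : seq I) (h : I -> T -> R) :
  (forall i, bmeas (h i)) -> bmeas (fun x => \sum_(i <- r) h i x).
Proof.
move=> bh; elim: r => [|i r IHr].
  under eq_fun do rewrite big_nil; exact: bmeas_cst.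
by under eq_fun do rewrite big_cons; exact: bmeasD.
Qed.

Lemma bmeas_indic (A : set T) : measurable A -> bmeas (\1_A : T -> R).
Proof.
move=> mA; split; first exact: measurable_indic.
by exists 1 => x; rewrite indicE; case: (_ \in _); rewrite ?normr1 ?normr0.
Qed.

Variable P : probability T R.

Lemma bmeas_integrable h : bmeas h -> P.-integrable setT (EFin \o h).
Proof.
move=> [mh [K hK]]; apply: measurable_bounded_integrable => //.
  by rewrite (le_lt_trans (probability_le1 P measurableT))// ltry.
exists K; split; first exact: num_real.
by move=> M KM x _; exact: le_trans (hK x) (ltW KM).
Qed.

Lemma bmeas_integralE h : bmeas h ->
  (\int[P]_x (h x)%:E)%E = (\int[P]_x h x)%:E.
Proof.
move=> bh; rewrite /Rintegral fineK//.
exact: integrable_fin_num (bmeas_integrable bh).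
Qed.

Lemma RintD h g : bmeas h -> bmeas g ->
  \int[P]_x (h x + g x) = \int[P]_x h x + \int[P]_x g x.
Proof. by move=> bh bg; rewrite RintegralD//; exact: bmeas_integrable. Qed.

Lemma RintB h g : bmeas h -> bmeas g ->
  \int[P]_x (h x - g x) = \int[P]_x h x - \int[P]_x g x.
Proof. by move=> bh bg; rewrite RintegralB//; exact: bmeas_integrable. Qed.

Lemma RintZ (c : R) h : bmeas h -> \int[P]_x (c * h x) = c * \int[P]_x h x.
Proof. by move=> bh; rewrite RintegralZl//; exact: bmeas_integrable. Qed.

Lemma Rint_cst (c : R) : \int[P]_x c = c.
Proof. by rewrite Rintegral_cst// [X in fine X](probability_setT P) mulr1. Qed.

Lemma Rint_sum (I : Type) (r : seq I) (h : I -> T -> R) :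
  (forall i, bmeas (h i)) ->
  \int[P]_x (\sum_(i <- r) h i x) = \sum_(i <- r) \int[P]_x h i x.
Proof.
move=> bh; elim: r => [|i r IHr].
  rewrite big_nil -[RHS]Rint_cst; apply: eq_Rintegral => x _.
  by rewrite big_nil.
rewrite big_cons -IHr -RintD//; last exact: bmeas_sum.
by apply: eq_Rintegral => x _; rewrite big_cons.
Qed.

Lemma Rint_le h g : bmeas h -> bmeas g -> (forall x, h x <= g x) ->
  \int[P]_x h x <= \int[P]_x g x.
Proof.
by move=> bh bg hg; apply: le_Rintegral => //; exact: bmeas_integrable.
Qed.

Lemma Rint_norm_le h (K : R) : measurable_fun setT h ->
  (forall x, `|h x| <= K) -> `|\int[P]_x h x| <= K.
Proof.
move=> mh hK; have bh : bmeas h by split => //; exists K.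
rewrite (le_trans (le_normr_Rintegral _ (bmeas_integrable bh)))//.
by rewrite -[leRHS]Rint_cst; apply: Rint_le => //;
  [exact: bmeas_norm|exact: bmeas_cst].
Qed.

Lemma Rint_indic (A : set T) : measurable A ->
  \int[P]_x \1_A x = fine (P A).
Proof. by move=> mA; rewrite /Rintegral integral_indic// setIT. Qed.

Lemma bounded_convergence (h_ : nat -> T -> R) h (K : R) :
  (forall n, measurable_fun setT (h_ n)) -> measurable_fun setT h ->
  (forall n x, `|h_ n x| <= K) ->
  {ae P, forall x, h_ ^~ x @ \oo --> h x} ->
  \int[P]_x h_ n x @[n --> \oo] --> \int[P]_x h x.
Proof.
move=> mh_ mh hK hh.
have mE_ n : measurable_fun setT (EFin \o h_ n) by exact/measurable_EFinP.
have mE : measurable_fun setT (EFin \o h) by exact/measurable_EFinP.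
have cvgE : {ae P, forall x, setT x ->
    (EFin \o h_ n) x @[n --> \oo] --> (EFin \o h) x}.
  by apply: filterS hh => x hx _; exact: cvg_EFin (nearW _ _) hx.
have iK : P.-integrable setT (EFin \o cst K).
  by apply: bmeas_integrable; exact: bmeas_cst.
have dom : {ae P, forall x n, setT x ->
    (`|(EFin \o h_ n) x| <= (EFin \o cst K) x)%E}.
  by apply: aeW => x n _ /=; rewrite lee_fin.
have [ih _ cvgI] := dominated_convergence measurableT mE_ mE cvgE iK dom.
apply: fine_cvg.
by rewrite fineK ?integrable_fin_num.
Qed.

End bounded_measurable.

Lemma bmeas_comp {R : realType} d1 d2 (T1 : measurableType d1)
    (T2 : measurableType d2) (h : T2 -> R) (u : T1 -> T2) :
  bmeas h -> measurable_fun setT u -> bmeas (fun x => h (u x)).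
Proof.
by move=> [mh [K hK]] mu; split; [exact: measurableT_comp|exists K].
Qed.

Lemma Rint_distribution {R : realType} d1 d3 (T1 : measurableType d1)
    (T3 : measurableType d3) (P : probability T3 R) (Z : {mfun T3 >-> T1})
    (h : T1 -> R) : bmeas h ->
  \int[distribution P Z]_x h x = \int[P]_w h (Z w).
Proof.
move=> [mh [K hK]]; congr fine.
rewrite integral_pushforward//; first exact/measurable_EFinP.
rewrite preimage_setT.
apply: (bmeas_integrable P (h := h \o Z)).
by split; [exact: measurableT_comp|exists K => x; exact: hK].
Qed.

Lemma Rint_law {R : realType} dO (Omega : measurableType dO)
    (P : probability Omega R) dT (T : measurableType dT) (mu : probability T R)
    (X : {RV P >-> T}) (h : T -> R) : has_law X mu -> bmeas h ->
  \int[mu]_x h x = \int[P]_w h (X w).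
Proof.
move=> hX bh; rewrite -Rint_distribution//; congr fine.
by apply: eq_measure_integral => A mA _; exact/esym/hX.
Qed.

(** * Averaging out an independent variable *)

Section freezing.
Context {R : realType} d1 d2 d3 (T1 : measurableType d1)
  (T2 : measurableType d2) (T3 : measurableType d3).

Lemma bmeas_fubini (mu : probability T2 R) (F : T1 * T2 -> R) :
  bmeas F -> bmeas (fun x => \int[mu]_y F (x, y)).
Proof.
move=> [mF [K FK]]; split; last first.
  by exists K => x; apply: Rint_norm_le => //; exact: measurableT_comp.
(* Adding the bound [K] makes the integrand nonnegative, so that Tonelli's theorem gives
   measurability; the constant is subtracted again afterwards. *)
pose G (z : T1 * T2) : \bar R := (F z + K)%:E.
have mG : measurable_fun setT (fun x => (\int[mu]_y G (x, y))%E).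
  apply: (measurable_fun_fubini_tonelli_F G) => //.
    by apply/measurable_EFinP; exact: measurable_funD.
  by move=> x; rewrite lee_fin; have := FK x; rewrite ler_norml; lra.
have -> : (fun x => \int[mu]_y F (x, y)) =
    (fun x => fine ((\int[mu]_y G (x, y))%E) - K).
  apply/funext => x.
  have bx : bmeas (fun y => F (x, y)).
    by split; [exact: measurableT_comp|exists K].
  have -> : fine (\int[mu]_y G (x, y))%E = \int[mu]_y (F (x, y) + K) by [].
  by rewrite RintD ?Rint_cst ?addrK//; exact: bmeas_cst.
by apply: measurable_funB => //; exact: measurableT_comp.
Qed.

Lemma Rint_prod12 (m1 : probability T1 R) (m2 : probability T2 R)
    (F : T1 * T2 -> R) : bmeas F ->
  \int[(m1 \x m2)%E]_z F z = \int[m1]_x \int[m2]_y F (x, y).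
Proof.
move=> bF; rewrite {1}/Rintegral -integral12_prod_meas1//; last first.
  exact: (bmeas_integrable (m1 \x m2)%E).
rewrite /Rintegral; congr fine; apply: eq_integral => x _.
rewrite -(bmeas_integralE m2)//.
exact: (bmeas_comp bF (pair1_measurable x)).
Qed.

Lemma Rint_prod21 (m1 : probability T1 R) (m2 : probability T2 R)
    (F : T1 * T2 -> R) : bmeas F ->
  \int[(m1 \x m2)%E]_z F z = \int[m2]_y \int[m1]_x F (x, y).
Proof.
move=> bF; rewrite {1}/Rintegral -integral21_prod_meas1//; last first.
  exact: (bmeas_integrable (m1 \x m2)%E).
rewrite /Rintegral; congr fine; apply: eq_integral => y _.
rewrite -(bmeas_integralE m1)//.
exact: (bmeas_comp bF (pair2_measurable y)).
Qed.

Context (P : probability T3 R) (mu : probability T2 R).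
Variables (Z : {mfun T3 >-> T1}) (W : {mfun T3 >-> T2}).
Hypothesis indepZW : forall A B, measurable A -> measurable B ->
  P (Z @^-1` A `&` W @^-1` B) = (P (Z @^-1` A) * mu B)%E.

(** The law of [(Z, W)] and the product of the two laws agree on rectangles by [indepZW], hence
    everywhere. *)
Let freezing_joint (F : T1 * T2 -> R) : bmeas F ->
  \int[P]_w F (Z w, W w) = \int[(distribution P Z \x mu)%E]_z F z.
Proof.
move=> [mF [K FK]].
pose ZW := fun w => (Z w, W w).
have mZW : measurable_fun setT ZW by exact: measurable_fun_pair.
pose ZW' : {mfun T3 >-> (T1 * T2)%type} :=
  MeasurableFun.Pack (MeasurableFun.Class (isMeasurableFun.Build _ _ _ _ _ mZW)).
have E A : measurable A -> (distribution P Z \x mu)%E A = distribution P ZW' A.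
  apply: product_measure_unique => A' B mA mB.
  by rewrite -indepZW.
transitivity (\int[distribution P ZW']_z F z).
  by rewrite Rint_distribution//; split => //; exists K.
by congr fine; apply: eq_measure_integral => A mA _; exact/esym/E.
Qed.

Lemma freezing1 (F : T1 * T2 -> R) : bmeas F ->
  \int[P]_w F (Z w, W w) = \int[P]_w \int[mu]_y F (Z w, y).
Proof.
move=> bF; rewrite freezing_joint// Rint_prod12// Rint_distribution//.
exact: bmeas_fubini.
Qed.

Lemma freezing2 (F : T1 * T2 -> R) : bmeas F ->
  \int[P]_w F (Z w, W w) = \int[mu]_y \int[P]_w F (Z w, y).
Proof.
move=> bF; rewrite freezing_joint// Rint_prod21//.
apply: eq_Rintegral => y _; rewrite Rint_distribution//.
exact: (bmeas_comp bF (pair2_measurable y)).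
Qed.

End freezing.

(** * Norms on 'rV[R]_d *)

Lemma measurable_pred dS (S : measurableType dS) (p : S -> bool) :
  measurable_fun setT p -> measurable [set s | p s].
Proof. by move=> mp; rewrite -[X in measurable X]setTI; exact: (mp _ [set true]). Qed.

Section norm_theory.
Context {R : realType} {d : nat} {N : 'rV[R]_d -> R} (hN : is_norm N).
Implicit Types x y z : 'rV[R]_d.

Lemma is_norm0 : N 0 = 0.
Proof. by rewrite -(scale0r 0) (is_normZ hN) normr0 mul0r. Qed.

Lemma is_normN x : N (- x) = N x.
Proof. by rewrite -scaleN1r (is_normZ hN) normrN1 mul1r. Qed.

Lemma is_norm_distC x y : N (x - y) = N (y - x).
Proof. by rewrite -is_normN opprB. Qed.

Lemma is_norm_distD z x y : N (x - y) <= N (x - z) + N (z - y).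
Proof.
by apply: le_trans (is_norm_triangle hN _ _); rewrite addrA subrK.
Qed.

Lemma is_norm_dist0 x y : N (x - y) = 0 -> x = y.
Proof. by move=> /(is_norm_eq0 hN)/eqP; rewrite subr_eq0 => /eqP. Qed.

Lemma is_norm_le_coord x : N x <= \sum_j `|x 0 j| * N 'e_j.
Proof.
rewrite {1}(row_sum_delta x); apply: (big_ind2 (fun a (b : R) => N a <= b)) => [||j _].
- by rewrite is_norm0.
- by move=> a b c e ab ce; rewrite (le_trans (is_norm_triangle hN _ _))// lerD.
- by rewrite (is_normZ hN).
Qed.

Lemma coord_le_mx_norm x (j : 'I_d) : `|x 0 j| <= `|x|.
Proof.
rewrite [leRHS]/Num.norm /= mx_normrE.
by apply/bigmax_geP; right => /=; exists (0, j).
Qed.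

Lemma is_norm_le_mx_norm : exists2 C : R, 0 < C & forall x, N x <= C * `|x|.
Proof.
have S0 : 0 <= \sum_j N 'e_j by apply: sumr_ge0 => j _; exact: is_norm_ge0.
(* The summand 1 keeps the constant positive even when the sum is empty, as for [d = 0]. *)
exists (1 + \sum_j N 'e_j); first by rewrite ltr_pwDl.
move=> x; apply: le_trans (is_norm_le_coord x) _.
rewrite mulrDl mul1r mulr_suml ler_wpDl//.
by apply: ler_sum => j _; rewrite mulrC ler_wpM2l ?coord_le_mx_norm ?is_norm_ge0.
Qed.

Lemma is_norm_continuous : continuous N.
Proof.
have [C C0 NC] := is_norm_le_mx_norm.
move=> x; apply/(@cvgrPdist_lt _ _ _ (nbhs x)) => e e0; near=> y.
have distN a b : N a - N b <= N (a - b).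
  by rewrite lerBlDr -{1}(subrK b a); exact: is_norm_triangle.
rewrite (@le_lt_trans _ _ (N (x - y)))//.
  by rewrite ler_norml distN lerNl opprB is_norm_distC distN.
rewrite (le_lt_trans (NC _))// mulrC -ltr_pdivlMr//.
by near: y; apply: cvgr_dist_lt => //; rewrite divr_gt0.
Unshelve. all: by end_near. Qed.

(** Equivalence of norms: [N] is continuous, so on the compact unit sphere of the sup norm it
    attains a minimum, which is positive. [0 < d] makes this sphere nonempty. *)
Lemma mx_norm_le_is_norm : (0 < d)%N ->
  exists2 c : R, 0 < c & forall x, c * `|x| <= N x.
Proof.
move=> d0.
pose S := [set x : 'rV[R]_d | `|x| = 1].
have S1 : S !=set0.
  exists (const_mx 1); rewrite /S /= {1}/Num.norm /= mx_normrE.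
  apply/eqP; rewrite eq_le; apply/andP; split.
    by apply: bigmax_le => // i _; rewrite mxE normr1.
  by apply/bigmax_geP; right => /=; exists (0, Ordinal d0); rewrite ?mxE ?normr1.
have cS : compact S.
  apply: bounded_closed_compact.
    by exists 1; split; [exact: num_real|move=> M M1 x /= ->; exact: ltW].
  have -> : S = Num.norm @^-1` [set 1 : R] by [].
  apply: closed_comp; last exact: closed_eq.
  by move=> x _; exact: norm_continuous.
have [x0 x0S x0min] := compact_EVT_min S1 cS (continuous_subspaceT is_norm_continuous).
exists (N x0).
  rewrite lt_def (is_norm_ge0 hN) andbT; apply/eqP => /(is_norm_eq0 hN) x00.
  by move: x0S; rewrite inE /S /= x00 normr0 => /eqP; rewrite eq_sym oner_eq0.
move=> x; have [->|xn0] := eqVneq x 0; first by rewrite normr0 mulr0 is_norm0.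
have x_gt0 : 0 < `|x| by rewrite normr_gt0.
have /x0min : `|x|^-1 *: x \in S.
  by rewrite inE /S /= normrZ normfV normr_id mulVf// gt_eqF.
by rewrite (is_normZ hN) normfV normr_id mulrC ler_pdivlMr.
Qed.

(** The ambient topology is that of the sup norm; norm equivalence carries convergence for [N] over
    to it. *)
Lemma is_norm_cvg (u : nat -> 'rV[R]_d) x : (0 < d)%N ->
  N (x - u n) @[n --> \oo] --> 0 -> u @ \oo --> x.
Proof.
move=> /mx_norm_le_is_norm[c c0 cN] Nu.
apply/cvgrPdist_lt => e e0.
move/cvgrPdist_lt : Nu => /(_ _ (mulr_gt0 c0 e0)); apply: filterS => n.
rewrite sub0r normrN (ger0_norm (is_norm_ge0 hN _)) => xu.
by rewrite -(ltr_pM2l c0) (le_lt_trans (cN _)).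
Qed.

Lemma rat_dense_is_norm x (r : R) : 0 < r ->
  exists q : 'rV[rat]_d, N (x - map_mx ratr q) < r.
Proof.
move=> r0; have S0 : 0 <= \sum_j N 'e_j by apply: sumr_ge0 => j _; exact: is_norm_ge0.
(* Tolerance per coordinate: an error below [e] in each coordinate costs at most
   [e * \sum_j N 'e_j], which is less than [r]. *)
pose e := r / (1 + \sum_j N 'e_j).
have e0 : 0 < e by rewrite divr_gt0// ltr_pwDl.
have /choice[q qP] (j : 'I_d) : exists q : rat, ratr q \in `]x 0 j, x 0 j + e[.
  by apply: rat_in_itvoo; rewrite ltrDl.
exists (\row_j q j).
apply: le_lt_trans (is_norm_le_coord _) _.
apply: (@le_lt_trans _ _ (e * \sum_j N 'e_j)).
  rewrite mulr_sumr; apply: ler_sum => j _; rewrite ler_wpM2r ?is_norm_ge0//.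
  have := qP j; rewrite in_itv/= => /andP[q1 q2].
  by rewrite !mxE ltr0_norm ?subr_lt0// opprB lerBlDl ltW.
by rewrite /e mulrAC ltr_pdivrMr ?ltr_pM2l//; [rewrite ltrDr|rewrite ltr_pwDl].
Qed.

Lemma continuous_measurable_rV (g : 'rV[R]_d -> R) :
  continuous g -> measurable_fun setT g.
Proof.
move=> cg; apply: (measurability _ (RGenOInfty.measurableE R)) => //.
move=> /= _ [_ [a ->] <-]; rewrite setTI; apply: sub_sigma_algebra => /=.
by apply: open_comp => // x _; exact: cg.
Qed.

(* [measurable] on a product is the product sigma-algebra: a countable dense set reduces the distance to functions of one variable. *)
Lemma measurable_is_norm_sub dS (S : measurableType dS) (U V : S -> 'rV[R]_d) :
  measurable_fun setT U -> measurable_fun setT V ->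
  measurable_fun setT (fun s => N (U s - V s)).
Proof.
move=> mU mV; apply: (measurability _ (RGenCInfty.measurableE R)) => //.
move=> /= _ [_ [a ->] <-]; rewrite setTI.
have mN (q : 'rV[R]_d) : measurable_fun setT (fun x => N (x - q)).
  apply: continuous_measurable_rV => x.
  apply: (@continuous_comp _ _ _ (fun x => x - q) N); last exact: is_norm_continuous.
  exact: (cvgB cvg_id (cvg_cst _)).
rewrite [X in measurable X](_ : _ = ~` \bigcup_(q : 'rV[rat]_d)
  [set s | N (U s - map_mx ratr q) + N (V s - map_mx ratr q) < a]).
  apply: measurableC; apply: countable_bigcupT_measurable => // q.
  apply: measurable_pred; apply: measurable_fun_ltr => //.
  by apply: measurable_funD; apply: (measurableT_comp (mN _)).
apply/seteqP; split => s /=; rewrite in_itv/= andbT.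
  move=> aN [q _ /=]; apply/negP; rewrite -leNgt (le_trans aN)//.
  by rewrite [N (V s - _)]is_norm_distC; exact: is_norm_distD.
apply: contra_notT; rewrite -ltNge => Na.
have e0 : 0 < (a - N (U s - V s)) / 2 by rewrite divr_gt0// subr_gt0.
have [q qP] := rat_dense_is_norm (V s) e0.
exists q => //=; have := is_norm_distD (V s) (U s) (map_mx ratr q).
by lra.
Qed.

Lemma measurable_closed_ball_of x (r : R) : measurable (closed_ball_of N x r).
Proof.
apply: measurable_pred; apply: measurable_fun_ler => //.
exact: measurable_is_norm_sub.
Qed.

Lemma measurable_eq_rV dS (S : measurableType dS) (U V : S -> 'rV[R]_d) :
  measurable_fun setT U -> measurable_fun setT V ->
  measurable_fun setT (fun s => U s == V s).
Proof.
move=> mU mV; rewrite (_ : (fun s => _) = (fun s => N (U s - V s) == 0)).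
  by apply: measurable_fun_eqr => //; exact: measurable_is_norm_sub.
apply/funext => s; apply/eqP/eqP => [->|/is_norm_dist0//].
by rewrite subrr is_norm0.
Qed.

(** A point outside the support lies in a null ball with rational centre and radius of the form
    1/(k+1); there are countably many such balls, so their union is null. *)
Lemma supp_ae (mu : probability 'rV[R]_d R) : {ae mu, forall x, supp N mu x}.
Proof.
pose B (qk : 'rV[rat]_d * nat) := closed_ball_of N (map_mx ratr qk.1) qk.2.+1%:R^-1.
pose F n := if unpickle n is Some qk then
  if mu (B qk) == 0%E then B qk else set0 else set0.
have : mu.-negligible (\bigcup_n F n).
  apply: negligible_bigcup => n; rewrite /F; case: unpickle => [qk|]; last first.
    exact: negligible_set0.
  case: ifPn => [/eqP B0|_]; last exact: negligible_set0.
  by exists (B qk); split => //; exact: measurable_closed_ball_of.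
apply: negligibleS => x /= /existsNP[r /not_implyP[r0]].
move/negP; rewrite -leNgt measure_le0 => /eqP Br.
(* With radius below [r / 2] and a centre within that radius of [x], the ball contains [x] and stays
   inside the null ball of radius [r]. *)
have [k kr] : exists k : nat, k.+1%:R^-1 < r / 2.
  have r20 : 0 < r / 2 by rewrite divr_gt0.
  have [k _ /(_ k (leqnn k)) /= kr] := near_infty_natSinv_lt (PosNum r20).
  by exists k.
have k0 : 0 < k.+1%:R^-1 :> R by rewrite invr_gt0.
have [q qx] := rat_dense_is_norm x k0.
exists (pickle (q, k)) => //; rewrite /F pickleK.
have BB : B (q, k) `<=` closed_ball_of N x r.
  move=> y; rewrite /B /closed_ball_of /= => qy.
  apply: le_trans (is_norm_distD (map_mx ratr q) x y) _.
  rewrite (splitr r) lerD// ltW//; first exact: lt_trans qx kr.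
  exact: le_lt_trans qy kr.
have -> : mu (B (q, k)) = 0%E.
  apply/eqP; rewrite -measure_le0 -Br le_measure ?inE//;
    exact: measurable_closed_ball_of.
by rewrite eqxx /B /closed_ball_of /= is_norm_distC ltW.
Qed.

End norm_theory.

(** * Nearest neighbours *)

Section countable_index.
Context dS (S : measurableType dS) dT (T : measurableType dT).

Lemma measurable_find (l : seq nat) (p : nat -> S -> bool) :
  (forall j, measurable_fun setT (p j)) ->
  measurable_fun setT (fun s => find (p^~ s) l).
Proof.
move=> mp; elim: l => [|j l IHl] /=; first exact: measurable_cst.
apply: measurable_fun_ifT => //.
exact: (measurableT_comp (f := succn)).
Qed.

Lemma measurable_all (I : Type) (l : seq I) (p : I -> S -> bool) :
  (forall j, measurable_fun setT (p j)) ->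
  measurable_fun setT (fun s => all (p^~ s) l).
Proof.
move=> mp; elim: l => [|j l IHl] /=; first exact: measurable_cst.
exact: measurable_and.
Qed.

(** The random index takes countably many values, and on each level set [J = j] the map is the
    measurable function [H j]. *)
Lemma measurable_nat_index (J : S -> nat) (H : nat -> S -> T) :
  measurable_fun setT J -> (forall j, measurable_fun setT (H j)) ->
  measurable_fun setT (fun s => H (J s) s).
Proof.
move=> mJ mH _ A mA; rewrite setTI.
rewrite (_ : _ @^-1` _ = \bigcup_j (J @^-1` [set j] `&` H j @^-1` A)).
  apply: bigcupT_measurable => j; apply: measurableI.
    by rewrite -[X in measurable X]setTI; exact: mJ.
  by rewrite -[X in measurable X]setTI; exact: mH.
by apply/seteqP; split => s /= => [AH|[j _ [/= <-]]]; first by exists (J s).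
Qed.

End countable_index.

Section nearest_neighbour.
Context {R : realType} {d : nat} {N : 'rV[R]_d -> R} (hN : is_norm N).
Implicit Types (x : 'rV[R]_d) (xs : nat -> 'rV[R]_d).

Let nn_has m xs x : (0 < m)%N ->
  has (fun j => [forall k : 'I_m, N (x - xs j) <= N (x - xs k)]) (iota 0 m).
Proof.
case: m => // m _.
have [i _ imin] := @arg_minP _ _ 'I_m.+1 ord0 xpredT (fun k => N (x - xs k)) isT.
apply/hasP; exists (i : nat); first by rewrite mem_iota add0n ltn_ord.
by apply/forallP => k; exact: imin.
Qed.

Lemma nn_index_lt m xs x : (0 < m)%N -> (nn_index N m xs x < m)%N.
Proof. by move=> m0; rewrite -[ltnRHS](size_iota 0) -has_find nn_has. Qed.

Lemma nn_index_min m xs x k : (k < m)%N ->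
  N (x - xs (nn_index N m xs x)) <= N (x - xs k).
Proof.
move=> km; have m0 : (0 < m)%N by exact: leq_ltn_trans km.
have /(nth_find 0%N)/forallP/(_ (Ordinal km)) := nn_has xs x m0.
by rewrite nth_iota ?add0n//; exact: nn_index_lt.
Qed.

(** Exchange of the two sums: each query point counts in exactly one weight, that of its nearest
    neighbour, and the factors [m] cancel. *)
Lemma nn_estimatorE m n xs xs' (zs : nat -> R) : (0 < m)%N ->
  nn_estimator N m n xs xs' zs =
  n%:R^-1 * \sum_(i < n) zs (nn_index N m xs' (xs i)).
Proof.
move=> m0; rewrite /nn_estimator /nn_weight.
under eq_bigr do rewrite -!mulrA mulr_suml.
rewrite -mulr_sumr mulrA mulVf ?mul1r ?pnatr_eq0 -?lt0n//.
rewrite -mulr_sumr exchange_big/=; congr (_ * _); apply: eq_bigr => i _.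
rewrite (bigD1 (Ordinal (nn_index_lt xs' (xs i) m0)))//= eqxx mul1r.
rewrite big1 ?addr0// => j; rewrite -val_eqE /= => /negbTE ->.
by rewrite mul0r.
Qed.

Lemma measurable_nn_index dS (S : measurableType dS) m
    (U : S -> 'rV[R]_d) (V : nat -> S -> 'rV[R]_d) :
  measurable_fun setT U -> (forall j, measurable_fun setT (V j)) ->
  measurable_fun setT (fun s => nn_index N m (V^~ s) (U s)).
Proof.
move=> mU mV; apply: (measurable_find _
  (p := fun j s => [forall k : 'I_m, N (U s - V j s) <= N (U s - V k s)])) => j.
rewrite (_ : (fun s => _) =
    (fun s => all (fun k : 'I_m => N (U s - V j s) <= N (U s - V k s)) (enum 'I_m))).
  apply: (measurable_all _
    (p := fun (k : 'I_m) s => N (U s - V j s) <= N (U s - V k s))) => k.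
  by apply: measurable_fun_ler; exact: measurable_is_norm_sub.
apply/funext => s; apply/forallP/allP => [H k _|H k]; first exact: H.
by apply: H; rewrite mem_enum.
Qed.

(** As soon as [j < m], the nearest neighbour among the first [m] points is at least as close as
    [xs j]. *)
Lemma nn_index_cvg xs x :
  (forall r : R, 0 < r -> exists j, N (x - xs j) <= r) ->
  N (x - xs (nn_index N m xs x)) @[m --> \oo] --> 0.
Proof.
move=> near_x; apply/cvgrPdist_lt => e e0.
have [j jP] := near_x _ (divr_gt0 e0 (ltr0n R 2)).
exists j.+1 => // m /= jm.
rewrite sub0r normrN ger0_norm ?(is_norm_ge0 hN)//.
rewrite (le_lt_trans (nn_index_min xs x jm))// (le_lt_trans jP)//.
by rewrite ltr_pdivrMr// ltr_pMr// ltr1n.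
Qed.

End nearest_neighbour.

(** * Almost sure approach of a support point by an i.i.d. sample *)

Section iid_dense.
Context {R : realType} {d : nat} {N : 'rV[R]_d -> R} (hN : is_norm N).
Context dO (Omega : measurableType dO) (P : probability Omega R).
Variables (mu : probability 'rV[R]_d R) (Xs : nat -> {RV P >-> 'rV[R]_d}).
Hypothesis hXs : iid Xs mu.

Lemma sigma_rv_preimage dT (T : measurableType dT) (X : {RV P >-> T}) A :
  measurable A -> sigma_rv X (X @^-1` A).
Proof. by move=> mA; exists A => //; rewrite setTI. Qed.

Lemma iid_avoid (A : set 'rV[R]_d) (n : nat) : measurable A ->
  P (\bigcap_(j < n) Xs j @^-1` A) = ((fine (mu A)) ^+ n)%:E.
Proof.
move=> mA; have [law ind] := hXs.
have -> : \bigcap_(j < n) Xs j @^-1` A =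
    \bigcap_(j in [set` iota 0 n]) Xs j @^-1` A.
  by congr bigcap; apply/seteqP; split => j /=; rewrite mem_iota.
rewrite ind ?iota_uniq//; last by move=> i _; exact: sigma_rv_preimage.
rewrite (eq_bigr (fun=> (fine (mu A))%:E)); last first.
  by move=> j _; rewrite fineK ?fin_num_measure// -(law j).
by rewrite prodEFin big_const_seq count_predT size_iota iter_mulr mulr1.
Qed.

(** Every ball around a point of the support has positive mass, so the probability that the first
    [n] sample points all avoid it decays geometrically. Almost surely every ball of radius 1/(k+1)
    is hit, and [nn_index_cvg] applies. *)
Lemma iid_nn_cvg x : supp N mu x ->
  {ae P, forall w, N (x - Xs (nn_index N m (Xs^~ w) x) w) @[m --> \oo] --> 0}.
Proof.
move=> xsupp.
pose A k := ~` closed_ball_of N x k.+1%:R^-1.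
have mA k : measurable (A k) by apply: measurableC; exact: measurable_closed_ball_of.
have A1 k : 0 <= fine (mu (A k)) < 1.
  rewrite fine_ge0//= -lte_fin fineK ?fin_num_measure//.
  rewrite probability_setC; last exact: measurable_closed_ball_of.
  have := xsupp k.+1%:R^-1; rewrite invr_gt0 ltr0n => /(_ isT).
  rewrite -[mu (closed_ball_of _ _ _)]fineK ?fin_num_measure//; last first.
    exact: measurable_closed_ball_of.
  by rewrite -EFinB !lte_fin; lra.
have negl k : P.-negligible (\bigcap_j Xs j @^-1` A k).
  have mX j : measurable (Xs j @^-1` A k).
    by rewrite -[X in measurable X]setTI; exact: measurable_funP.
  exists (\bigcap_j Xs j @^-1` A k); split => //.
    by apply: bigcap_measurableType => j _; exact: mX.
  apply/eqP; rewrite -measure_le0; apply/lee_addgt0Pr => e e0; rewrite add0e.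
  have /andP[q0 q1] := A1 k.
  have /cvgrPdist_lt/(_ e e0)[n _ /(_ n (leqnn n))] :
      fine (mu (A k)) ^+ n @[n --> \oo] --> 0.
    by apply: cvg_expr; rewrite ger0_norm.
  rewrite /= sub0r normrN ger0_norm ?exprn_ge0// => qe.
  apply: le_trans (_ : (fine (mu (A k)) ^+ n)%:E <= _)%E; last by rewrite lee_fin ltW.
  rewrite -iid_avoid//; apply: le_measure; rewrite ?inE.
  - by apply: bigcap_measurableType => j _; exact: mX.
  - by apply: bigcap_measurableType => j _; exact: mX.
  - by move=> w Aw j _; exact: Aw.
have := negligible_bigcup negl; apply: negligibleS => w /=.
apply: contra_notP => far.
apply: (nn_index_cvg hN (xs := Xs^~ w)) => r r0.
have [k _ /(_ k (leqnn k)) /= kr] := near_infty_natSinv_lt (PosNum r0).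
have : ~ (\bigcap_j Xs j @^-1` A k) w by move=> Aw; apply: far; exists k.
rewrite /bigcap /= => /existsNP[j /not_implyP[_ /contrapT]].
by rewrite /closed_ball_of /= => jk; exists j; rewrite (le_trans jk)// ltW.
Qed.

End iid_dense.

(** * Independence *)

(* Independence from a sub-sigma-algebra is handled by regarding the identity as a random variable with values in [Omega] equipped with the smaller sigma-algebra. *)
Section sub_sigma_algebra.
Context {R : realType} dO (Omega : measurableType dO) (P : probability Omega R).
Variable G : set (set Omega).
Hypotheses (GM : G `<=` measurable) (GT : G setT) (GI : setI_closed G).

(** For fixed [B] both sides are finite measures in [A], a restriction and a multiple of [P];
    agreeing on the pi-system [G], they agree on the sigma-algebra it generates. *)
Lemma independent_g_sigma (B : set Omega) : measurable B ->
  (forall A, G A -> P (A `&` B) = (P A * P B)%E) ->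
  forall A, <<s G >> A -> P (A `&` B) = (P A * P B)%E.
Proof.
move=> mB GB A GA.
have PB0 : 0 <= fine (P B) by rewrite fine_ge0.
have PBE A' : (P A' * P B)%E = mscale (NngNum PB0) P A'.
  by rewrite /mscale/= fineK ?fin_num_measure// muleC.
rewrite PBE; apply: (g_sigma_algebra_measure_unique G GM (fun=> setT) _ _
  (mrestr P mB) (mscale (NngNum PB0) P)) => //.
- by rewrite bigcup_const//; exists 0%N.
- by move=> A' GA' /=; rewrite -PBE; exact: GB.
- by move=> _; rewrite (le_lt_trans (probability_le1 P _))// ?ltry// setTI.
Qed.

Lemma measurable_to_g_sigma :
  measurable_fun setT (id : Omega -> g_sigma_algebraType G).
Proof.
move=> _ A mA; rewrite setTI preimage_id.
exact: (smallest_sub (@sigma_algebra_measurable _ Omega) GM).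
Qed.

Let idG : {mfun Omega >-> g_sigma_algebraType G} :=
  MeasurableFun.Pack (MeasurableFun.Class
    (isMeasurableFun.Build _ _ _ _ _ measurable_to_g_sigma)).

Lemma measurable_from_g_sigma dT (T : measurableType dT) (U : {RV P >-> T}) :
  sigma_rv U `<=` <<s G >> ->
  measurable_fun setT (U : g_sigma_algebraType G -> T).
Proof. by move=> UG _ A mA; apply: UG; exists A. Qed.

Context dT (T : measurableType dT) (mu : probability T R) (W : {RV P >-> T}).
Hypotheses (hW : has_law W mu)
  (GW : forall A B, G A -> measurable B ->
     P (A `&` W @^-1` B) = (P A * P (W @^-1` B))%E).

Let indepGW (A : set (g_sigma_algebraType G)) B : measurable A -> measurable B ->
  P (idG @^-1` A `&` W @^-1` B) = (P (idG @^-1` A) * mu B)%E.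
Proof.
move=> mA mB; rewrite -(hW mB) preimage_id; apply: independent_g_sigma => //.
  by rewrite -[X in measurable X]setTI; exact: measurable_funP.
by move=> A' GA'; exact: GW.
Qed.

(** The first argument of [F] can carry any number of variables at once, provided they are
    measurable for [<<s G >>]; only the independent [W] is averaged. *)
Lemma freezing_g_sigma1 (F : g_sigma_algebraType G * T -> R) : bmeas F ->
  \int[P]_w F (w, W w) = \int[P]_w \int[mu]_y F (w, y).
Proof. by move=> bF; exact: (freezing1 (Z := idG) indepGW bF). Qed.

Lemma freezing_g_sigma2 (F : g_sigma_algebraType G * T -> R) : bmeas F ->
  \int[P]_w F (w, W w) = \int[mu]_y \int[P]_w F (w, y).
Proof. by move=> bF; exact: (freezing2 (Z := idG) indepGW bF). Qed.

End sub_sigma_algebra.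

Section pi_systems.
Context {T : Type}.

(** When both systems contain the whole space, this pi-system generates their join; product formulas
    for probabilities are checked on it and then extended. *)
Definition setI_system (F G : set (set T)) : set (set T) :=
  [set A `&` B | A in F & B in G].

Lemma setI_system_setI F G :
  setI_closed F -> setI_closed G -> setI_closed (setI_system F G).
Proof.
move=> FI GI _ _ [A FA [B GB <-]] [A' FA' [B' GB' <-]].
by exists (A `&` A'); [exact: FI|exists (B `&` B'); [exact: GI|rewrite setIACA]].
Qed.

Lemma setI_system_setT F G : F setT -> G setT -> setI_system F G setT.
Proof. by move=> FT GT; exists setT => //; exists setT => //; rewrite setTI. Qed.

Lemma sub_setI_systeml F G : G setT -> F `<=` setI_system F G.
Proof. by move=> GT A FA; exists A => //; exists setT => //; rewrite setIT. Qed.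

Lemma sub_setI_systemr F G : F setT -> G `<=` setI_system F G.
Proof. by move=> FT B GB; exists setT => //; exists B => //; rewrite setTI. Qed.

End pi_systems.

Lemma setI_system_measurable dO (Omega : measurableType dO)
    (F G : set (set Omega)) :
  F `<=` measurable -> G `<=` measurable -> setI_system F G `<=` measurable.
Proof. by move=> FM GM _ [A FA [B GB <-]]; apply: measurableI; [exact: FM|exact: GM]. Qed.

Section independence_theory.
Context {R : realType} dO (Omega : measurableType dO) (P : probability Omega R).

Lemma independent_systems2 (I : eqType) (F : I -> set (set Omega)) i j A B :
  independent_systems P F -> i != j -> F i A -> F j B ->
  P (A `&` B) = (P A * P B)%E.
Proof.
move=> indF ij FA FB; pose C k := if k == i then A else B.
have Ci : C i = A by rewrite /C eqxx.
have Cj : C j = B by rewrite /C eq_sym (negbTE ij).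
have uij : uniq [:: i; j] by rewrite /= inE ij.
have FC k : k \in [:: i; j] -> F k (C k).
  by rewrite !inE => /orP[]/eqP ->; rewrite ?Ci ?Cj.
have := indF _ _ uij FC; rewrite !big_cons big_nil mule1 Ci Cj => <-.
congr (P _); apply/seteqP; split => w.
  by move=> [Aw Bw] k /=; rewrite !inE => /orP[]/eqP ->; rewrite ?Ci ?Cj.
by move=> Cw; split; [rewrite -Ci|rewrite -Cj]; apply: Cw; rewrite /= !inE eqxx ?orbT.
Qed.

Lemma independent_systems3 (F : 'I_3 -> set (set Omega)) A B C :
  independent_systems P F -> F (inord 0) A -> F (inord 1) B -> F (inord 2) C ->
  P (A `&` B `&` C) = (P A * P B * P C)%E.
Proof.
move=> indF FA FB FC; pose D (k : 'I_3) := nth set0 [:: A; B; C] k.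
have [D0 D1 D2] : [/\ D (inord 0) = A, D (inord 1) = B & D (inord 2) = C].
  by split; rewrite /D inordK.
have us : uniq [:: inord 0; inord 1; inord 2 : 'I_3].
  by rewrite /= !inE -!val_eqE /= !inordK.
have FD k : k \in [:: inord 0; inord 1; inord 2 : 'I_3] -> F k (D k).
  by rewrite !inE => /or3P[]/eqP ->; rewrite ?D0 ?D1 ?D2.
have := indF _ _ us FD; rewrite !big_cons big_nil mule1 D0 D1 D2 muleA => <-.
congr (P _); apply/seteqP; split => w.
  by move=> [[Aw Bw] Cw] k /=; rewrite !inE => /or3P[]/eqP ->; rewrite ?D0 ?D1 ?D2.
move=> Dw; split; first split; [rewrite -D0|rewrite -D1|rewrite -D2];
  by apply: Dw; rewrite /= !inE eqxx ?orbT.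
Qed.

End independence_theory.

Section sigma_systems.
Context dO (Omega : measurableType dO) dT (T : measurableType dT).

Lemma sigma_rv_measurable (X : {mfun Omega >-> T}) : sigma_rv X `<=` measurable.
Proof. by move=> _ [A mA <-]; exact: measurable_funP. Qed.

Lemma sigma_rv_setT (X : Omega -> T) : sigma_rv X setT.
Proof. by exists setT => //; rewrite preimage_setT setIT. Qed.

Lemma sigma_rv_setI (X : Omega -> T) : setI_closed (sigma_rv X).
Proof.
move=> _ _ [A mA <-] [B mB <-]; exists (A `&` B); first exact: measurableI.
by rewrite preimage_setI !setTI.
Qed.

Lemma sigma_seq_measurable (X : nat -> {mfun Omega >-> T}) :
  sigma_seq (fun i => X i : Omega -> T) `<=` measurable.
Proof.
apply: (smallest_sub (@sigma_algebra_measurable _ Omega)) => A [i _].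
exact: sigma_rv_measurable.
Qed.

Lemma sigma_seq_setT (X : nat -> Omega -> T) : sigma_seq X setT.
Proof. exact: (@measurableT _ (g_sigma_algebraType (\bigcup_i sigma_rv (X i)))). Qed.

Lemma sigma_seq_setI (X : nat -> Omega -> T) : setI_closed (sigma_seq X).
Proof.
by move=> A B; exact: (@measurableI _ (g_sigma_algebraType (\bigcup_i sigma_rv (X i)))).
Qed.

Lemma sigma_rv_sub_seq (X : nat -> Omega -> T) i :
  sigma_rv (X i) `<=` sigma_seq X.
Proof. by move=> A XA; apply: sub_sigma_algebra; exists i. Qed.

End sigma_systems.

(** * Averages *)

Lemma cvg_pair_fst (R : realType) (u : nat -> R) (l : R) : u @ \oo --> l ->
  u mn.1 @[mn --> (\oo, \oo)] --> l.
Proof.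
move=> ul; apply: (@cvg_comp _ _ _ (@fst nat nat) u (filter_prod \oo \oo) \oo _ _ ul).
exact: cvg_fst.
Qed.

Lemma cvg_pair_snd (R : realType) (u : nat -> R) (l : R) : u @ \oo --> l ->
  u mn.2 @[mn --> (\oo, \oo)] --> l.
Proof.
move=> ul; apply: (@cvg_comp _ _ _ (@snd nat nat) u (filter_prod \oo \oo) \oo _ _ ul).
exact: cvg_snd.
Qed.

Lemma cvg_invn (R : realType) : n%:R^-1 @[n --> \oo] --> (0 : R).
Proof. by rewrite -cvg_shiftS; exact: cvg_harmonic. Qed.

Lemma bmeas_bool {R : realType} dS (S : measurableType dS) (p : S -> bool) :
  measurable_fun setT p -> bmeas (fun s => (p s)%:R : R).
Proof.
move=> mp; split.
  rewrite (_ : (fun s => _) = (fun s => if p s then 1 else 0)).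
    exact: measurable_fun_ifT.
  by apply/funext => s; case: (p s).
by exists 1 => s; case: (p s); rewrite ?normr1 ?normr0.
Qed.

Lemma bmeas_nat_index {R : realType} dS (S : measurableType dS)
    (J : S -> nat) dT (T : measurableType dT) (h : T -> R) (H : nat -> S -> T) :
  measurable_fun setT J -> bmeas h -> (forall j, measurable_fun setT (H j)) ->
  bmeas (fun s => h (H (J s) s)).
Proof. by move=> mJ bh mH; apply: bmeas_comp bh _; exact: measurable_nat_index. Qed.

(** Expands a value at a random index over fixed indices, where each term can be treated by
    freezing. *)
Lemma sum_indic_eq {R : realType} (m J : nat) (h : nat -> R) : (J < m)%N ->
  h J = \sum_(j < m) (J == j)%:R * h j.
Proof.
move=> Jm; rewrite (bigD1 (Ordinal Jm))//= eqxx mul1r big1 ?addr0// => j.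
by rewrite -val_eqE /= eq_sym => /negbTE ->; rewrite mul0r.
Qed.

Section second_moment.
Context {R : realType} dO (Omega : measurableType dO) (P : probability Omega R).

(** Expanding the square gives [n] diagonal terms between 0 and [M ^+ 2], and off-diagonal terms
    equal to [c]. The lower bound drops the diagonal; the upper bound replaces each diagonal term by
    [c + M ^+ 2]. *)
Lemma second_moment_avg (D : nat -> Omega -> R) (M c : R) (n : nat) :
  (0 < n)%N -> 0 <= c ->
  (forall i, measurable_fun setT (D i)) -> (forall i w, `|D i w| <= M) ->
  (forall i k, i != k -> \int[P]_w (D i w * D k w) = c) ->
  (1 - n%:R^-1) * c <= \int[P]_w ((n%:R^-1 * \sum_(i < n) D i w) ^+ 2)
    <= M ^+ 2 / n%:R + c.
Proof.
move=> n0 c0 mD DM covD.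
have bD i : bmeas (D i) by split => //; exists M.
have n0' : n%:R != 0 :> R by rewrite pnatr_eq0 -lt0n.
have n1 : n%:R * n%:R^-1 = 1 :> R by rewrite divff.
have -> : \int[P]_w ((n%:R^-1 * \sum_(i < n) D i w) ^+ 2) =
    n%:R^-1 ^+ 2 * \sum_(i < n) \sum_(k < n) \int[P]_w (D i w * D k w).
  under eq_bigr => i _ do rewrite -(Rint_sum P _ (fun k : 'I_n => bmeasM (bD i) (bD k))).
  rewrite -Rint_sum; last by move=> i; apply: bmeas_sum => k; exact: bmeasM.
  rewrite -RintZ; last first.
    by apply: bmeas_sum => i; apply: bmeas_sum => k; exact: bmeasM.
  apply: eq_Rintegral => w _; rewrite exprMn; congr (_ * _).
  by rewrite expr2 mulr_suml; apply: eq_bigr => i _; rewrite mulr_sumr.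
have sqD i : 0 <= \int[P]_w (D i w * D i w) <= M ^+ 2.
  rewrite Rintegral_ge0 => [|w _]; last by rewrite -expr2 sqr_ge0.
  rewrite (le_trans (ler_norm _))//; apply: Rint_norm_le => [|w].
    exact: measurable_funM.
  by rewrite normrM expr2 ler_pM.
have bnd i k : c - (i == k)%:R * c <= \int[P]_w (D i w * D k w) <=
    c + (i == k)%:R * M ^+ 2.
  case: eqVneq => [<-|ik]; last by rewrite covD// !mul0r subr0 addr0 lexx.
  by have /andP[lo hi] := sqD i; rewrite !mul1r subrr lo/= (le_trans hi)// lerDr.
have sumE (x y : R) : n%:R^-1 ^+ 2 *
    \sum_(i < n) \sum_(k < n) (x + ((i : nat) == k)%:R * y) = x + y / n%:R.
  have row (i : 'I_n) :
      \sum_(k < n) (x + ((i : nat) == k)%:R * y) = x *+ n + y.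
    rewrite big_split/= sumr_const card_ord; congr (_ + _).
    by rewrite -(sum_indic_eq (fun=> y) (ltn_ord i)).
  under eq_bigr do rewrite row.
  rewrite sumr_const card_ord -mulr_natr -[x *+ n]mulr_natr.
  by field.
have n2 : 0 <= n%:R^-1 ^+ 2 :> R by rewrite sqr_ge0.
apply/andP; split.
  have -> : (1 - n%:R^-1) * c = c + (- c) / n%:R by ring.
  rewrite -sumE ler_wpM2l//; apply: ler_sum => i _; apply: ler_sum => k _.
  by rewrite mulrN; case/andP: (bnd i k).
rewrite addrC -sumE ler_wpM2l//; apply: ler_sum => i _; apply: ler_sum => k _.
by case/andP: (bnd i k).
Qed.

(** Pointwise, expanding the square of [|h| - e] gives [e |h| <= e ^+ 2 + h ^+ 2]. This stands in
    for Cauchy-Schwarz: when the second moment vanishes in the limit, the first moment is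
    asymptotically at most [e]. *)
Lemma Rint_norm_le_sqr (h : Omega -> R) (e : R) : 0 < e -> bmeas h ->
  \int[P]_w `|h w| <= e + (\int[P]_w (h w ^+ 2)) / e.
Proof.
move=> e0 bh.
have bh2 : bmeas (fun w => h w ^+ 2) by exact: bmeasM.
have beh : bmeas (fun w => e^-1 * h w ^+ 2).
  by apply: bmeasM => //; exact: bmeas_cst.
have -> : e + (\int[P]_w (h w ^+ 2)) / e = \int[P]_w (e + e^-1 * h w ^+ 2).
  rewrite RintD//; last exact: bmeas_cst.
  by rewrite RintZ// Rint_cst mulrC.
apply: Rint_le => [||w]; first exact: bmeas_norm.
  by apply: bmeasD => //; exact: bmeas_cst.
rewrite -(ler_pM2l e0) mulrDr mulVKf ?gt_eqF//.
rewrite -[h w ^+ 2]real_normK; last exact: num_real.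
have : 0 <= (`|h w| - e) ^+ 2 by exact: sqr_ge0.
have : 0 <= e * `|h w| by rewrite mulr_ge0// ltW.
rewrite sqrrB -mulr_natr [`|h w| * e]mulrC expr2.
by lra.
Qed.

End second_moment.

(** * Moments of the estimator *)

Section fiber_moments.
Context {R : realType} dS (S : measurableType dS) dT (T : measurableType dT).
Context (mu : probability T R).
Implicit Types g : S * T -> R.

(** For [g = phi \o f], the three definitions that follow are psi, the output centred by psi, and
    vartheta. *)
Definition fiber_mean g (x : S) : R := \int[mu]_t g (x, t).

Definition fiber_dev g (z : S * T) : R := g z - fiber_mean g z.1.

Definition fiber_var g (x : S) : R := \int[mu]_t (fiber_dev g (x, t) ^+ 2).

Lemma bmeas_fiber_mean g : bmeas g -> bmeas (fiber_mean g).
Proof. exact: bmeas_fubini. Qed.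

Lemma bmeas_fiber_dev g : bmeas g -> bmeas (fiber_dev g).
Proof.
by move=> bg; apply: bmeasB => //; exact: bmeas_comp (bmeas_fiber_mean bg) measurable_fst.
Qed.

Lemma bmeas_fiber_var g : bmeas g -> bmeas (fiber_var g).
Proof.
move=> /bmeas_fiber_dev bdev.
by apply: (@bmeas_fubini _ _ _ _ _ mu (fun z => fiber_dev g z ^+ 2)); exact: bmeasM.
Qed.

Lemma fiber_var_ge0 g x : 0 <= fiber_var g x.
Proof. by apply: Rintegral_ge0 => t _; exact: sqr_ge0. Qed.

Lemma fiber_mean_dev g x : bmeas g -> \int[mu]_t fiber_dev g (x, t) = 0.
Proof.
move=> bg; rewrite /fiber_dev/= RintB; last exact: bmeas_cst.
  by rewrite Rint_cst subrr.
exact: bmeas_comp bg (pair1_measurable x).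
Qed.

End fiber_moments.

Section model.
Context {R : realType} {d : nat} {N : 'rV[R]_d -> R} (hd : (0 < d)%N)
  (hN : is_norm N).
Context dTh (Th : measurableType dTh) (g : 'rV[R]_d * Th -> R) (bg : bmeas g).
Context (muX muX' : probability 'rV[R]_d R) (muTh : probability Th R).
Context dO (Omega : measurableType dO) (P : probability Omega R).
Context (Xs Xs' : nat -> {RV P >-> 'rV[R]_d}) (Thetas : nat -> {RV P >-> Th}).
Hypotheses (hXs : iid Xs muX) (hXs' : iid Xs' muX') (hThetas : iid Thetas muTh).
Hypothesis hindep : independent_systems P
     (fun k : 'I_3 => nth set0
        [:: sigma_seq (fun i => Xs i : Omega -> 'rV[R]_d);
            sigma_seq (fun j => Xs' j : Omega -> 'rV[R]_d);
            sigma_seq (fun j => Thetas j : Omega -> Th)] k).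

Local Notation sX := (sigma_seq (fun i => Xs i : Omega -> 'rV[R]_d)).
Local Notation sX' := (sigma_seq (fun i => Xs' i : Omega -> 'rV[R]_d)).
Local Notation sTh := (sigma_seq (fun i => Thetas i : Omega -> Th)).

Let indep3 A B C : sX A -> sX' B -> sTh C ->
  P (A `&` B `&` C) = (P A * P B * P C)%E.
Proof. by move=> sA sB sC; apply: (independent_systems3 hindep); rewrite inordK. Qed.

Let sXT : sX setT. Proof. exact: sigma_seq_setT. Qed.
Let sX'T : sX' setT. Proof. exact: sigma_seq_setT. Qed.

Local Notation nn m x w := (nn_index N m (fun j => Xs' j w) x).
Local Notation J m i w := (nn m (Xs i w) w).

(** * Averaging out one parameter [Thetas j] *)

Section one_theta.
Variables (j k : nat) (jk : j != k).

(** The variables frozen while [Thetas j] is averaged: all query and reference points, hence all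
    nearest-neighbour indices, and one further parameter [Thetas k]. *)
Local Notation G := (setI_system (setI_system sX sX') (sigma_rv (Thetas k))).

Let GM : G `<=` measurable.
Proof.
by apply: setI_system_measurable; [apply: setI_system_measurable|];
  [exact: sigma_seq_measurable..|exact: sigma_rv_measurable].
Qed.

Let GT : G setT.
Proof.
apply: setI_system_setT; last exact: sigma_rv_setT.
by apply: setI_system_setT; exact: sigma_seq_setT.
Qed.

Let GI : setI_closed G.
Proof.
apply: setI_system_setI; last exact: sigma_rv_setI.
by apply: setI_system_setI; exact: sigma_seq_setI.
Qed.

(** [hindep] separates the points from the parameters, and among the parameters [Thetas k] is
    independent of [Thetas j]. *)
Let GW A B : G A -> measurable B ->
  P (A `&` Thetas j @^-1` B) = (P A * P (Thetas j @^-1` B))%E.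
Proof.
move=> [_ [A1 sA1 [A2 sA2 <-]] [C sC <-]] mB.
have sThC : sTh C by exact: (sigma_rv_sub_seq (X := fun j => Thetas j)) sC.
have sThB : sTh (Thetas j @^-1` B).
  by apply: (sigma_rv_sub_seq (X := fun j => Thetas j) (i := j));
    exact: sigma_rv_preimage.
rewrite -[X in P X]setIA indep3//; last exact: sigma_seq_setI.
rewrite (independent_systems2 hThetas.2 (i := k) (j := j))//.
- by rewrite indep3// muleA.
- by rewrite eq_sym.
- exact: sigma_rv_preimage.
Qed.

Let mX i : measurable_fun setT (Xs i : g_sigma_algebraType G -> _).
Proof.
apply: measurable_from_g_sigma; apply: (subset_trans _ (@sub_sigma_algebra _ _ _)).
apply: (subset_trans _ (sub_setI_systeml (sigma_rv_setT _))).
apply: (subset_trans _ (sub_setI_systeml sX'T)).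
exact: (sigma_rv_sub_seq (X := fun j => Xs j)).
Qed.

Let mX' i : measurable_fun setT (Xs' i : g_sigma_algebraType G -> _).
Proof.
apply: measurable_from_g_sigma; apply: (subset_trans _ (@sub_sigma_algebra _ _ _)).
apply: (subset_trans _ (sub_setI_systeml (sigma_rv_setT _))).
apply: (subset_trans _ (sub_setI_systemr sXT)).
exact: (sigma_rv_sub_seq (X := fun j => Xs' j)).
Qed.

Let mTh : measurable_fun setT (Thetas k : g_sigma_algebraType G -> _).
Proof.
apply: measurable_from_g_sigma; apply: (subset_trans _ (@sub_sigma_algebra _ _ _)).
apply: sub_setI_systemr.
by apply: setI_system_setT; exact: sigma_seq_setT.
Qed.

Variables (m i i' : nat).

Local Notation u a b w := ((J m i w == a)%:R * (J m i' w == b)%:R : R).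

Let bu a b : bmeas (fun w : g_sigma_algebraType G => u a b w).
Proof.
have mJ l c : measurable_fun setT (fun w : g_sigma_algebraType G => J m l w == c).
  apply: (measurableT_comp (f := fun n : nat => n == c)) => //.
  exact: (measurable_nn_index hN).
by apply: bmeasM; apply: bmeas_bool; exact: mJ.
Qed.

Let bdev := bmeas_fiber_dev muTh bg.

Let mG1 (F : g_sigma_algebraType G -> R) : bmeas F ->
  bmeas (fun z : g_sigma_algebraType G * Th => F z.1).
Proof. by move=> bF; exact: bmeas_comp bF measurable_fst. Qed.

Lemma cross_moment_offdiag :
  \int[P]_w (u j k w * (fiber_dev muTh g (Xs' j w, Thetas j w) *
                        fiber_dev muTh g (Xs' k w, Thetas k w))) = 0.
Proof.
pose F (z : g_sigma_algebraType G * Th) : R :=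
  u j k z.1 * fiber_dev muTh g (Xs' k z.1, Thetas k z.1) *
  fiber_dev muTh g (Xs' j z.1, z.2).
have bk : bmeas (fun w : g_sigma_algebraType G =>
    u j k w * fiber_dev muTh g (Xs' k w, Thetas k w)).
  apply: bmeasM => //; apply: bmeas_comp bdev _.
  by apply: measurable_fun_pair.
have bF : bmeas F.
  apply: bmeasM; first exact: (mG1 bk).
  apply: bmeas_comp bdev _; apply: measurable_fun_pair => //.
  exact: measurableT_comp (mX' j) measurable_fst.
transitivity (\int[P]_w F (w, Thetas j w)).
  by apply: eq_Rintegral => w _; rewrite /F /=; ring.
rewrite (freezing_g_sigma1 GM GT GI (hThetas.1 j) GW bF).
rewrite -[RHS](Rint_cst P); apply: eq_Rintegral => w _.
rewrite /F/= RintZ ?fiber_mean_dev ?mulr0//.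
exact: bmeas_comp bdev (pair1_measurable _).
Qed.

Lemma cross_moment_diag :
  \int[P]_w (u j j w * (fiber_dev muTh g (Xs' j w, Thetas j w) *
                        fiber_dev muTh g (Xs' j w, Thetas j w))) =
  \int[P]_w (u j j w * fiber_var muTh g (Xs' j w)).
Proof.
pose F (z : g_sigma_algebraType G * Th) : R :=
  u j j z.1 * fiber_dev muTh g (Xs' j z.1, z.2) ^+ 2.
have bdev2 : bmeas (fun z => fiber_dev muTh g z ^+ 2) by exact: bmeasM.
have bF : bmeas F.
  apply: bmeasM; first exact: (mG1 (bu _ _)).
  apply: bmeas_comp bdev2 _; apply: measurable_fun_pair => //.
  exact: measurableT_comp (mX' j) measurable_fst.
transitivity (\int[P]_w F (w, Thetas j w)); first exact: eq_Rintegral.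
rewrite (freezing_g_sigma1 GM GT GI (hThetas.1 j) GW bF).
apply: eq_Rintegral => w _; rewrite /F/= RintZ//.
exact: bmeas_comp bdev2 (pair1_measurable _).
Qed.

End one_theta.
Local Notation psi := (fiber_mean muTh g).
Local Notation vth := (fiber_var muTh g).
Local Notation dev m i w :=
  (fiber_dev muTh g (Xs' (J m i w) w, Thetas (J m i w) w)).

Let mJ m i : measurable_fun setT (fun w => J m i w).
Proof. exact: (measurable_nn_index hN). Qed.

Let bJ m i (a : nat) : bmeas (fun w => (J m i w == a)%:R : R).
Proof.
by apply: bmeas_bool; apply: (measurableT_comp (f := fun n : nat => n == a)).
Qed.

Let bdev_ j : bmeas (fun w => fiber_dev muTh g (Xs' j w, Thetas j w)).
Proof.
by apply: bmeas_comp (bmeas_fiber_dev muTh bg) _; exact: measurable_fun_pair.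
Qed.

Let bvar_ j : bmeas (fun w => fiber_var muTh g (Xs' j w)).
Proof. exact: bmeas_comp (bmeas_fiber_var muTh bg) _. Qed.

(** Both indices are expanded over their possible values. Terms with different values vanish, equal
    values give the variance, and the remaining sum folds back into the event that the indices
    coincide. *)
Lemma cross_moment m i i' : (0 < m)%N ->
  \int[P]_w (dev m i w * dev m i' w) =
  \int[P]_w ((J m i w == J m i' w)%:R * fiber_var muTh g (Xs' (J m i w) w)).
Proof.
move=> m0; pose a l j w : R := (J m l w == j)%:R.
pose D j w := fiber_dev muTh g (Xs' j w, Thetas j w).
have devE l w : dev m l w = \sum_(j < m) a l j w * D j w.
  exact: (sum_indic_eq (fun j => D j w) (nn_index_lt (Xs'^~ w) (Xs l w) m0)).
have ba l j : bmeas (a l j) by exact: bJ.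
have bD j : bmeas (D j) by exact: bdev_.
have baD (j k : nat) : bmeas (fun w => a i j w * a i' k w * (D j w * D k w)).
  by apply: bmeasM; apply: bmeasM.
transitivity (\sum_(j < m) \sum_(k < m)
    \int[P]_w (a i j w * a i' k w * (D j w * D k w))).
  under eq_bigr do rewrite -Rint_sum//.
  rewrite -Rint_sum; last by move=> j; exact: bmeas_sum.
  apply: eq_Rintegral => w _; rewrite !devE mulr_suml; apply: eq_bigr => j _.
  by rewrite mulr_sumr; apply: eq_bigr => k _; ring.
transitivity (\sum_(j < m) \int[P]_w (a i j w * a i' j w * fiber_var muTh g (Xs' j w))).
  apply: eq_bigr => j _; rewrite (bigD1 j)//= big1 ?addr0.
    (* The freezing argument carries a second parameter index different from [j]; [j.+1] supplies
       one. *)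
    by apply: (@cross_moment_diag j j.+1); rewrite neq_ltn ltnSn.
  by move=> k kj; apply: (@cross_moment_offdiag j k); rewrite eq_sym.
rewrite -Rint_sum; last first.
  by move=> j; apply: bmeasM => //; apply: bmeasM.
apply: eq_Rintegral => w _.
under eq_bigr do rewrite -mulrA.
rewrite -(sum_indic_eq (fun j => a i' j w * fiber_var muTh g (Xs' j w))).
  by rewrite /a eq_sym.
exact: nn_index_lt.
Qed.

(** * Averaging out one query point [Xs i] *)

Section one_x.
Variables (i k : nat) (ik : i != k).

(** The variables frozen while [Xs i] is averaged: one other query point and the whole reference
    sample. *)
Local Notation G := (setI_system (sigma_rv (Xs k)) sX').

Let GM : G `<=` measurable.
Proof.
by apply: setI_system_measurable;
  [exact: sigma_rv_measurable|exact: sigma_seq_measurable].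
Qed.

Let GT : G setT.
Proof. by apply: setI_system_setT; [exact: sigma_rv_setT|exact: sigma_seq_setT]. Qed.

Let GI : setI_closed G.
Proof. by apply: setI_system_setI; [exact: sigma_rv_setI|exact: sigma_seq_setI]. Qed.

Let GW A B : G A -> measurable B ->
  P (A `&` Xs i @^-1` B) = (P A * P (Xs i @^-1` B))%E.
Proof.
move=> [C sC [D sD <-]] mB.
have sXC : sX C by exact: (sigma_rv_sub_seq (X := fun j => Xs j)) sC.
have sB := sigma_rv_preimage (Xs i) mB.
have sXB : sX (Xs i @^-1` B) by exact: (sigma_rv_sub_seq (X := fun j => Xs j)) sB.
have sTT : sTh setT by exact: sigma_seq_setT.
have indep2 A' B' : sX A' -> sX' B' -> P (A' `&` B') = (P A' * P B')%E.
  by move=> sA' sB'; rewrite -[A' `&` B']setIT indep3// probability_setT mule1.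
rewrite setIAC indep2//; last exact: sigma_seq_setI.
rewrite (independent_systems2 hXs.2 (i := k) (j := i))//; last by rewrite eq_sym.
by rewrite indep2// muleAC.
Qed.

Lemma freezing_X (F : Omega * 'rV[R]_d -> R) :
  bmeas (F : g_sigma_algebraType G * 'rV[R]_d -> R) ->
  \int[P]_w F (w, Xs i w) = \int[muX]_x \int[P]_w F (w, x).
Proof. by move=> bF; exact: (freezing_g_sigma2 GM GT GI (hXs.1 i) GW bF). Qed.

Lemma measurable_from_X :
  measurable_fun setT (Xs k : g_sigma_algebraType G -> _).
Proof.
apply: measurable_from_g_sigma; apply: (subset_trans _ (@sub_sigma_algebra _ _ _)).
exact: (sub_setI_systeml sX'T).
Qed.

Lemma measurable_from_X' j :
  measurable_fun setT (Xs' j : g_sigma_algebraType G -> _).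
Proof.
apply: measurable_from_g_sigma; apply: (subset_trans _ (@sub_sigma_algebra _ _ _)).
apply: (subset_trans _ (sub_setI_systemr (sigma_rv_setT (Xs k)))).
exact: (sigma_rv_sub_seq (X := fun j => Xs' j)).
Qed.

End one_x.

Local Notation gamma m x y w :=
  ((nn m x w == nn m y w)%:R * vth (Xs' (nn m x w) w)).

Let bgamma dS (S : measurableType dS) m (U V : S -> 'rV[R]_d)
    (Z : nat -> S -> 'rV[R]_d) :
  measurable_fun setT U -> measurable_fun setT V ->
  (forall j, measurable_fun setT (Z j)) ->
  bmeas (fun s => (nn_index N m (Z^~ s) (U s) == nn_index N m (Z^~ s) (V s))%:R *
    vth (Z (nn_index N m (Z^~ s) (U s)) s)).
Proof.
move=> mU mV mZ; have mU' := measurable_nn_index hN m mU mZ.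
have mV' := measurable_nn_index hN m mV mZ.
apply: bmeasM; first by apply: bmeas_bool; exact: measurable_fun_eqn.
exact: (bmeas_nat_index mU' (bmeas_fiber_var muTh bg) mZ).
Qed.

(* The covariance of two distinct terms of the estimator: the conditional variance at the nearest neighbour, on the event that two independent query points share it. *)
Definition coincidence m :=
  \int[muX]_x \int[muX]_y \int[P]_w gamma m x y w.

Lemma coincidence_ge0 m : 0 <= coincidence m.
Proof.
do 3 (apply: Rintegral_ge0 => ? _).
by rewrite mulr_ge0// fiber_var_ge0.
Qed.

Local Notation OX k :=
  (g_sigma_algebraType (setI_system (sigma_rv (Xs k)) sX') * 'rV[R]_d)%type.

Let bpsi : bmeas psi. Proof. exact: bmeas_fiber_mean. Qed.

Let bvth : bmeas vth. Proof. exact: bmeas_fiber_var. Qed.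

(** Averaging [Xs i] and then [Xs i'] against [muX] leaves an expression in the reference sample
    alone, hence the same value for every pair. *)
Lemma coincidenceE m i i' : i != i' ->
  \int[P]_w gamma m (Xs i w) (Xs i' w) w = coincidence m.
Proof.
move=> ii'; have i'i : i' != i by rewrite eq_sym.
rewrite (freezing_X ii' (F := fun z => gamma m z.2 (Xs i' z.1) z.1)).
  apply: eq_Rintegral => x _.
  rewrite (freezing_X i'i (F := fun z => gamma m x z.2 z.1))//.
  apply: (bgamma m (S := OX i) (U := fun=> x) (V := snd)
    (Z := fun j z => Xs' j z.1)) => //.
  by move=> j; exact: measurableT_comp (@measurable_from_X' i j) measurable_fst.
apply: (bgamma m (S := OX i') (U := snd) (V := fun z => Xs i' z.1)
  (Z := fun j z => Xs' j z.1)) => //.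
  exact: measurableT_comp (@measurable_from_X i') measurable_fst.
by move=> j; exact: measurableT_comp (@measurable_from_X' i' j) measurable_fst.
Qed.

(** Bounds the L1 norm of the term B for every [n > 0], because all query points have the same
    law. *)
Definition nn_bias m :=
  \int[muX]_x \int[P]_w `|psi (Xs' (nn m x w) w) - psi x|.

Lemma nn_biasE m i :
  \int[P]_w `|psi (Xs' (J m i w) w) - psi (Xs i w)| = nn_bias m.
Proof.
have ii : i != i.+1 by rewrite neq_ltn ltnSn.
rewrite (freezing_X ii (F := fun z => `|psi (Xs' (nn m z.2 z.1) z.1) - psi z.2|))//.
apply: bmeas_norm; apply: bmeasB; last by apply: bmeas_comp bpsi _.
have mZ j : measurable_fun setT (fun z : OX i.+1 => Xs' j z.1).
  exact: measurableT_comp (@measurable_from_X' i.+1 j) measurable_fst.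
exact: bmeas_nat_index (measurable_nn_index hN m _ mZ) bpsi mZ.
Qed.

Lemma centered_moment i i' : i != i' ->
  \int[P]_w ((psi (Xs i w) - \int[muX]_x psi x) *
             (psi (Xs i' w) - \int[muX]_x psi x)) = 0.
Proof.
move=> ii'; set q := \int[muX]_x psi x.
have bc dS (S : measurableType dS) (u : S -> 'rV[R]_d) :
    measurable_fun setT u -> bmeas (fun s => psi (u s) - q).
  by move=> mu; apply: bmeasB; [exact: bmeas_comp bpsi mu|exact: bmeas_cst].
rewrite (freezing_X ii' (F := fun z => (psi z.2 - q) * (psi (Xs i' z.1) - q))).
  have cen : \int[muX]_x (psi x - q) = 0.
    by rewrite RintB ?Rint_cst ?subrr//; exact: bmeas_cst.
  rewrite -[RHS](mulr0 (\int[P]_w (psi (Xs i' w) - q))) -cen.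
  rewrite -RintZ; last exact: (bc _ _ id).
  by apply: eq_Rintegral => x _; rewrite /= RintZ 1?mulrC//; exact: bc.
apply: bmeasM; first exact: (bc _ _ snd).
apply: (bc _ (OX i') (fun z => Xs i' z.1)).
exact: measurableT_comp (@measurable_from_X i') measurable_fst.
Qed.

(** * Limits of the bias and of the coincidence term *)

Hypotheses (Lpsi : lipschitz_wrt N psi) (cvth : continuous vth)
  (hsupp : supp N muX `<=` supp N muX').

Let supp'_ae : {ae muX, forall x, supp N muX' x}.
Proof. by have := supp_ae hN muX; apply: filterS => x; exact: hsupp. Qed.

Let mZ1 j : measurable_fun setT (fun z : 'rV[R]_d * Omega => Xs' j z.2).
Proof. exact: measurableT_comp (measurable_funP _) measurable_snd. Qed.

(** Bounded convergence twice, in the sample for fixed [x] and then in [x]: almost every [x] lies in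
    the support of [muX'], where the Lipschitz bound is applied to a distance tending to 0. *)
Lemma nn_bias_cvg : nn_bias m @[m --> \oo] --> 0.
Proof.
have [L psiL] := Lpsi.
have [_ [K psiK]] := bpsi.
pose F m (z : 'rV[R]_d * Omega) : R := `|psi (Xs' (nn m z.1 z.2) z.2) - psi z.1|.
have bF m : bmeas (F m).
  apply: bmeas_norm; apply: bmeasB; last exact: bmeas_comp bpsi measurable_fst.
  exact: bmeas_nat_index (measurable_nn_index hN m measurable_fst mZ1) bpsi mZ1.
have FK m z : `|F m z| <= K + K.
  by rewrite normr_id (le_trans (ler_normB _ _))// lerD.
have bFx m x : bmeas (fun w => F m (x, w)).
  exact: bmeas_comp (bF m) (pair1_measurable x).
rewrite -[X in _ --> X](Rint_cst muX 0).
apply: (bounded_convergence (K := K + K)) => //.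
- by move=> m; exact: (bmeas_measurable (bmeas_fubini P (bF m))).
- move=> m x; apply: Rint_norm_le => [|w]; last exact: (FK m (x, w)).
  exact: bmeas_measurable (bFx m x).
apply: filterS supp'_ae => x xsupp.
rewrite -[X in _ --> X](Rint_cst P 0).
apply: (bounded_convergence (K := K + K)) => //.
- by move=> m; exact: bmeas_measurable (bFx m x).
- by move=> m w; exact: (FK m (x, w)).
have := iid_nn_cvg hN hXs' xsupp; apply: filterS => w wx.
apply: (@squeeze_cvgr _ _ _ _ (cst 0) (fun m => L * N (x - Xs' (nn m x w) w))).
- apply: nearW => m /=; rewrite normr_ge0/= (le_trans (psiL _ _))//.
  by rewrite is_norm_distC.
- exact: cvg_cst.
- by rewrite -[X in _ --> X](mulr0 L); apply: cvgMr.
Qed.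

(** If [x = y] the indicator is 1 and continuity of [vth] gives the limit. If [x != y], each nearest
    neighbour is eventually closer to its own point than half of [N (x - y)], so the two cannot
    coincide. *)
Let gamma_cvg x y w :
  N (x - Xs' (nn m x w) w) @[m --> \oo] --> 0 ->
  N (y - Xs' (nn m y w) w) @[m --> \oo] --> 0 ->
  gamma m x y w @[m --> \oo] --> (x == y)%:R * vth x.
Proof.
move=> wx wy; case: eqVneq => [<-|xy].
  under eq_fun do rewrite eqxx mul1r; rewrite mul1r.
  by apply: continuous_cvg; [exact: cvth|exact: (is_norm_cvg hN hd)].
rewrite mul0r; apply: cvg_near_cst.
have Nxy : 0 < N (x - y).
  rewrite lt_def (is_norm_ge0 hN) andbT; apply: contra_neq xy.
  exact: is_norm_dist0.
have Nxy2 : 0 < N (x - y) / 2 by rewrite divr_gt0.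
move/cvgrPdist_lt : wx => /(_ _ Nxy2) wx.
move/cvgrPdist_lt : wy => /(_ _ Nxy2) wy.
near=> m; case: eqVneq => [eqJ|_]; last by rewrite mul0r.
have : `|0 - N (x - Xs' (nn m x w) w)| < N (x - y) / 2 by near: m.
have : `|0 - N (y - Xs' (nn m y w) w)| < N (x - y) / 2 by near: m.
rewrite !sub0r !normrN !ger0_norm ?(is_norm_ge0 hN)// -eqJ => yz xz.
have := is_norm_distD hN (Xs' (nn m x w) w) x y.
by rewrite leNgt (splitr (N (x - y))) ltrD// is_norm_distC.
Unshelve. all: by end_near. Qed.

Let bdiag : bmeas (fun z : 'rV[R]_d * 'rV[R]_d => (z.1 == z.2)%:R * vth z.1).
Proof.
apply: bmeasM; last exact: bmeas_comp bvth measurable_fst.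
by apply: bmeas_bool; exact: (measurable_eq_rV hN).
Qed.

(** Bounded convergence three times, in [w], [y] and [x], since almost all [x] and [y] lie in the
    support of [muX']. *)
Lemma coincidence_cvg :
  coincidence m @[m --> \oo] --> \int[muX]_x \int[muX]_y ((x == y)%:R * vth x).
Proof.
have [_ [K vthK]] := bvth.
have K0 : 0 <= K by exact: le_trans (normr_ge0 _) (vthK 0).
pose F m (z : ('rV[R]_d * 'rV[R]_d) * Omega) : R := gamma m z.1.1 z.1.2 z.2.
have bF m : bmeas (F m).
  apply: (bgamma m (S := (('rV[R]_d * 'rV[R]_d) * Omega)%type)
    (U := fun z => z.1.1) (V := fun z => z.1.2) (Z := fun j z => Xs' j z.2)).
  - exact: measurableT_comp measurable_fst measurable_fst.
  - exact: measurableT_comp measurable_snd measurable_fst.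
  - by move=> j; exact: measurableT_comp (measurable_funP _) measurable_snd.
have indK (b : bool) x : `|b%:R * vth x| <= K.
  by case: b; rewrite ?mul1r// mul0r normr0.
have bFI m : bmeas (fun z => \int[P]_w F m (z, w)) by exact: bmeas_fubini.
have bFz m z : bmeas (fun w => F m (z, w)).
  exact: bmeas_comp (bF m) (pair1_measurable z).
have FIK m z : `|\int[P]_w F m (z, w)| <= K.
  by apply: Rint_norm_le => [|w]; [exact: bmeas_measurable (bFz m z)|exact: indK].
have bFIx m x : bmeas (fun y => \int[P]_w F m ((x, y), w)).
  exact: bmeas_comp (bFI m) (pair1_measurable x).
apply: (bounded_convergence (K := K)) => //.
- by move=> m; exact: (bmeas_measurable (bmeas_fubini muX (bFI m))).
- exact: (bmeas_measurable (bmeas_fubini muX bdiag)).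
- move=> m x; apply: Rint_norm_le => [|y]; last exact: (FIK m (x, y)).
  exact: bmeas_measurable (bFIx m x).
apply: filterS supp'_ae => x xsupp.
apply: (bounded_convergence (K := K)) => //.
- by move=> m; exact: bmeas_measurable (bFIx m x).
- exact: bmeas_measurable (bmeas_comp bdiag (pair1_measurable x)).
- by move=> m y; exact: (FIK m (x, y)).
apply: filterS supp'_ae => y ysupp.
rewrite -[X in _ --> X](Rint_cst P).
apply: (bounded_convergence (K := K)) => //.
- by move=> m; exact: bmeas_measurable (bFz m (x, y)).
- by have := iid_nn_cvg hN hXs' xsupp; have := iid_nn_cvg hN hXs' ysupp;
    apply: filterS2 => w wy wx; exact: gamma_cvg.
Qed.

Let m1 (a : 'rV[R]_d) : measurable [set a].
Proof.
rewrite (_ : [set a] = [set y | a == y]).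
  by apply: measurable_pred; exact: (measurable_eq_rV hN).
by apply/seteqP; split => y /= => [->//|/eqP].
Qed.

(** The inner integral is the mass of [x] times [vth x], which is nonnegative and vanishes off the
    atoms. Conversely, the double integral is at least the contribution of a single atom [a], its
    squared mass times [vth a]. *)
Lemma coincidence_lim_eq0 :
  \int[muX]_x \int[muX]_y ((x == y)%:R * vth x) = 0 <->
  forall a, atoms muX a -> vth a = 0.
Proof.
have eqE (x y : 'rV[R]_d) : (x == y)%:R = \1_[set x] y :> R.
  rewrite indicE; congr (nat_of_bool _)%:R.
  by apply/eqP/idP => [->|/set_mem ->//]; rewrite inE.
have innerE x : \int[muX]_y ((x == y)%:R * vth x) = fine (muX [set x]) * vth x.
  under eq_Rintegral do rewrite eqE mulrC.
  by rewrite RintZ ?Rint_indic 1?mulrC//; exact: bmeas_indic.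
split=> [lim0 a aX|vth0]; last first.
  rewrite -[RHS](Rint_cst muX); apply: eq_Rintegral => x _; rewrite innerE.
  have [->|x0] := eqVneq (muX [set x]) 0%E; first by rewrite mul0r.
  by rewrite vth0 ?mulr0// /atoms /= lt0e x0 measure_ge0.
have pa : 0 < fine (muX [set a]).
  apply: fine_gt0; apply/andP; split; first exact: aX.
  by rewrite (le_lt_trans (probability_le1 muX _))// ltry.
have binner : bmeas (fun x => \int[muX]_y ((x == y)%:R * vth x)).
  exact: (bmeas_fubini muX bdiag).
apply/eqP; rewrite eq_le fiber_var_ge0 andbT.
(* The mass of [a] is needed twice: one factor comes from the inner integral, the other from the
   outer integral over [[set a]]. *)
rewrite -(pmulr_rle0 _ pa) -(pmulr_rle0 _ pa) -lim0.
rewrite -[X in X * _](Rint_indic muX (m1 a)) mulrC -RintZ; last exact: bmeas_indic.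
apply: Rint_le => // [|x].
  by apply: bmeasM; [exact: bmeas_cst|exact: bmeas_indic].
rewrite innerE indicE; have [/set_mem/= ->|_] := boolP (x \in [set a]).
  by rewrite mulr1.
by rewrite mulr0 mulr_ge0 ?fiber_var_ge0// fine_ge0.
Qed.

(** * Error decomposition and L1 bounds in both directions *)

Local Notation q := (\int[muX]_x psi x).

Local Notation est m n w :=
  (n%:R^-1 * \sum_(i < n) g (Xs' (J m i w) w, Thetas (J m i w) w)).

Let A m n w := n%:R^-1 * \sum_(i < n) dev m i w.
Let B m n w := n%:R^-1 * \sum_(i < n) (psi (Xs' (J m i w) w) - psi (Xs i w)).
Let C n w := n%:R^-1 * \sum_(i < n) (psi (Xs i w) - q).

Let bavg n (D : nat -> Omega -> R) : (forall i, bmeas (D i)) ->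
  bmeas (fun w => n%:R^-1 * \sum_(i < n) D i w).
Proof.
by move=> bD; apply: bmeasM; [exact: bmeas_cst|apply: bmeas_sum => i; exact: bD].
Qed.

Let bdevJ m i : bmeas (fun w => dev m i w).
Proof.
apply: (bmeas_nat_index (H := fun j w => (Xs' j w, Thetas j w)) (mJ m i)
  (bmeas_fiber_dev muTh bg)) => j.
exact: measurable_fun_pair.
Qed.

Let bpsiX i : bmeas (fun w => psi (Xs i w)).
Proof. exact: bmeas_comp bpsi (measurable_funP _). Qed.

Let bpsiJ m i : bmeas (fun w => psi (Xs' (J m i w) w)).
Proof.
by apply: (bmeas_nat_index (H := fun j => Xs' j : Omega -> _) (mJ m i) bpsi).
Qed.

Let bA m n : bmeas (A m n).
Proof. by apply: (bavg _ (D := fun i w => dev m i w)). Qed.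

Let bB m n : bmeas (B m n).
Proof.
by apply: (bavg _ (D := fun i w => psi (Xs' (J m i w) w) - psi (Xs i w))) => i;
  exact: bmeasB.
Qed.

Let bC n : bmeas (C n).
Proof.
apply: (bavg _ (D := fun i w => psi (Xs i w) - q)) => i.
by apply: bmeasB => //; exact: bmeas_cst.
Qed.

Let estE m n w : (0 < n)%N -> est m n w - q = A m n w + (B m n w + C n w).
Proof.
move=> n0; rewrite /A /B /C -!mulrDr -!big_split/=.
have n1 : n%:R != 0 :> R by rewrite pnatr_eq0 -lt0n.
transitivity (n%:R^-1 *
    \sum_(i < n) (g (Xs' (J m i w) w, Thetas (J m i w) w) - q)).
  by rewrite sumrB mulrBr sumr_const card_ord -[q *+ n]mulr_natl mulKf.
by congr (_ * _); apply: eq_bigr => i _; rewrite /fiber_dev/=; ring.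
Qed.

Lemma bmeas_est m n : bmeas (fun w => est m n w).
Proof.
apply: (bavg _ (D := fun i w => g (Xs' (J m i w) w, Thetas (J m i w) w))) => i.
apply: (bmeas_nat_index (H := fun j w => (Xs' j w, Thetas j w)) (mJ m i) bg) => j.
exact: measurable_fun_pair.
Qed.

Let bS m n : bmeas (fun w => est m n w - q).
Proof. by apply: bmeasB; [exact: bmeas_est|exact: bmeas_cst]. Qed.

Let B_le m n : (0 < n)%N -> \int[P]_w `|B m n w| <= nn_bias m.
Proof.
move=> n0; have n1 : n%:R != 0 :> R by rewrite pnatr_eq0 -lt0n.
have bD i : bmeas (fun w => psi (Xs' (J m i w) w) - psi (Xs i w)) by exact: bmeasB.
have bnD i : bmeas (fun w => `|psi (Xs' (J m i w) w) - psi (Xs i w)|).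
  exact: bmeas_norm.
apply: (@le_trans _ _ (\int[P]_w (n%:R^-1 *
    \sum_(i < n) `|psi (Xs' (J m i w) w) - psi (Xs i w)|))).
  apply: Rint_le => [||w]; first exact: bmeas_norm.
    exact: (bavg _ (D := fun i w => `|psi (Xs' (J m i w) w) - psi (Xs i w)|)).
  by rewrite /B normrM ger0_norm ?invr_ge0// ler_wpM2l ?invr_ge0// ler_norm_sum.
rewrite RintZ; last by apply: bmeas_sum => i; exact: bnD.
rewrite Rint_sum; last by move=> i; exact: bnD.
under eq_bigr do rewrite nn_biasE.
by rewrite sumr_const card_ord -[nn_bias m *+ n]mulr_natl mulKf.
Qed.

Let bound : exists2 M : R, 0 <= M &
  [/\ forall z, `|fiber_dev muTh g z| <= M & forall x, `|psi x - q| <= M].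
Proof.
have [_ [K1 K1P]] := bmeas_fiber_dev muTh bg.
have [_ [K2 K2P]] : bmeas (fun x => psi x - q) by apply: bmeasB => //; exact: bmeas_cst.
exists (`|K1| + `|K2|); first by rewrite addr_ge0.
split=> [z|x].
  by rewrite (le_trans (K1P z))// (le_trans (ler_norm K1))// lerDl.
by rewrite (le_trans (K2P x))// (le_trans (ler_norm K2))// lerDr.
Qed.

Let C_le n (M e : R) : (0 < n)%N -> 0 < e -> (forall x, `|psi x - q| <= M) ->
  \int[P]_w `|C n w| <= e + (M ^+ 2 / n%:R) / e.
Proof.
move=> n0 e0 psiM; apply: le_trans (Rint_norm_le_sqr P e0 (bC n)) _.
rewrite lerD2l ler_pM2r ?invr_gt0//.
have mD i : measurable_fun setT (fun w => psi (Xs i w) - q).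
  by apply: bmeas_measurable; apply: bmeasB => //; exact: bmeas_cst.
have := second_moment_avg (P := P) (D := fun i w => psi (Xs i w) - q) n0 (lexx 0) mD
  (fun i w => psiM _) centered_moment.
by rewrite addr0 => /andP[].
Qed.

Let A_sqr m n (M : R) : (0 < m)%N -> (0 < n)%N ->
  (forall z, `|fiber_dev muTh g z| <= M) ->
  (1 - n%:R^-1) * coincidence m <= \int[P]_w (A m n w ^+ 2)
    <= M ^+ 2 / n%:R + coincidence m.
Proof.
move=> m0 n0 devM.
apply: (second_moment_avg (D := fun i w => dev m i w)) => //.
- exact: coincidence_ge0.
- by move=> i; exact: bmeas_measurable (bdevJ m i).
- by move=> i k ik; rewrite cross_moment// coincidenceE.
Qed.

(** Triangle inequality: A and C are bounded through their second moments, B by the bias. The free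
    parameter [e] is fixed when the limit is taken. *)
Let S_le m n (M e : R) : (0 < m)%N -> (0 < n)%N -> 0 < e ->
  (forall z, `|fiber_dev muTh g z| <= M) -> (forall x, `|psi x - q| <= M) ->
  \int[P]_w `|est m n w - q| <=
  (e + (M ^+ 2 / n%:R + coincidence m) / e) +
  (nn_bias m + (e + (M ^+ 2 / n%:R) / e)).
Proof.
move=> m0 n0 e0 devM psiM.
apply: (@le_trans _ _ (\int[P]_w (`|A m n w| + (`|B m n w| + `|C n w|)))).
  apply: Rint_le => [||w]; first exact: bmeas_norm.
    by apply: bmeasD; [exact: bmeas_norm|apply: bmeasD; exact: bmeas_norm].
  rewrite estE// (le_trans (ler_normD _ _))// lerD2l.
  exact: ler_normD.
rewrite RintD; [|exact: bmeas_norm|by apply: bmeasD; exact: bmeas_norm].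
rewrite RintD; [|exact: bmeas_norm..].
apply: lerD; last by apply: lerD; [exact: B_le|exact: C_le].
apply: le_trans (Rint_norm_le_sqr P e0 (bA m n)) _.
rewrite lerD2l ler_pM2r ?invr_gt0//.
by have /andP[] := A_sqr m0 n0 devM.
Qed.

(** As A is bounded by [M], its second moment is at most [M] times its L1 norm, and A is the error
    minus B and C. A small error thus forces a small [coincidence m]. *)
Let S_ge m n (M e : R) : (0 < m)%N -> (0 < n)%N -> 0 < e -> 0 <= M ->
  (forall z, `|fiber_dev muTh g z| <= M) -> (forall x, `|psi x - q| <= M) ->
  (1 - n%:R^-1) * coincidence m <=
  M * (\int[P]_w `|est m n w - q| + (nn_bias m + (e + (M ^+ 2 / n%:R) / e))).
Proof.
move=> m0 n0 e0 M0 devM psiM.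
have /andP[lo _] := A_sqr m0 n0 devM; apply: le_trans lo _.
have AM w : `|A m n w| <= M.
  rewrite /A normrM ger0_norm ?invr_ge0// ler_pdivrMl ?ltr0n//.
  rewrite (le_trans (ler_norm_sum _ _ _))// mulr_natl -[n in leRHS]card_ord.
  by rewrite -sumr_const; apply: ler_sum => i _; exact: devM.
apply: (@le_trans _ _ (\int[P]_w (M * `|A m n w|))).
  apply: Rint_le => [||w]; first exact: bmeasM.
    by apply: bmeasM; [exact: bmeas_cst|exact: bmeas_norm].
  by rewrite -[_ ^+ 2]real_normK ?num_real// expr2 ler_wpM2r.
rewrite RintZ; last exact: bmeas_norm.
rewrite ler_wpM2l//.
apply: (@le_trans _ _ (\int[P]_w (`|est m n w - q| + (`|B m n w| + `|C n w|)))).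
  apply: Rint_le => [||w]; first exact: bmeas_norm.
    apply: bmeasD; first exact: bmeas_norm (bS m n).
    by apply: bmeasD; exact: bmeas_norm.
  have -> : A m n w = (est m n w - q) - (B m n w + C n w) by rewrite estE// addrK.
  by rewrite (le_trans (ler_normB _ _))// lerD2l ler_normD.
rewrite RintD; [|exact: bmeas_norm (bS m n)|by apply: bmeasD; exact: bmeas_norm].
rewrite RintD; [|exact: bmeas_norm..].
by rewrite lerD2l; apply: lerD; [exact: B_le|exact: C_le].
Qed.

(** If the error vanishes, the limit of [S_ge] bounds [lim] by [M * e'] for every [e']; if
    [lim = 0], the upper bound [S_le] tends to [e + e]. *)
Lemma nn_mean_cvg_L1 :
  (\int[P]_w `|est mn.1 mn.2 w - q| @[mn --> (\oo, \oo)] --> 0) <->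
  forall a, atoms muX a -> vth a = 0.
Proof.
rewrite -coincidence_lim_eq0.
set lim := \int[muX]_x \int[muX]_y ((x == y)%:R * vth x).
have [M M0 [devM psiM]] := bound.
have cI : coincidence mn.1 @[mn --> (\oo, \oo)] --> lim.
  exact: cvg_pair_fst coincidence_cvg.
have cb : nn_bias mn.1 @[mn --> (\oo, \oo)] --> 0.
  exact: cvg_pair_fst nn_bias_cvg.
have cn : mn.2%:R^-1 @[mn --> (\oo, \oo)] --> (0 : R).
  exact: (cvg_pair_snd (u := fun n => n%:R^-1) (@cvg_invn R)).
have cMn : M ^+ 2 / mn.2%:R @[mn --> (\oo, \oo)] --> (0 : R).
  by rewrite -[X in _ --> X](mulr0 (M ^+ 2)); exact: cvgMr.
have pos1 : \forall mn \near (\oo, \oo), (0 < mn.1)%N /\ (0 < mn.2)%N.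
  by exists ([set m | (0 < m)%N], [set n | (0 < n)%N]) => //;
    split; exists 1%N.
split=> [S0|lim0].
  apply/eqP; rewrite eq_le; apply/andP; split; last first.
    apply: Rintegral_ge0 => x _; apply: Rintegral_ge0 => y _.
    by rewrite mulr_ge0 ?fiber_var_ge0.
  apply/ler_addgt0Pr => e e0; rewrite add0r.
  (* Dividing by [M + 1] gives [M * e' <= e] even if [M = 0]. *)
  pose e' := e / (M + 1).
  have e'0 : 0 < e' by rewrite divr_gt0// ltr_pwDr.
  apply: (@le_trans _ _ (M * e')); last first.
    by rewrite /e' mulrCA ler_piMr ?(ltW e0)// ler_pdivrMr ?mul1r ?lerDl// ltr_pwDr.
  have lhs : (1 - mn.2%:R^-1) * coincidence mn.1 @[mn --> (\oo, \oo)] --> lim.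
    rewrite -[X in _ --> X]mul1r -[X in X * _](subr0 1).
    by apply: cvgM => //; apply: cvgB => //; exact: cvg_cst.
  have rhs : M * (\int[P]_w `|est mn.1 mn.2 w - q| +
      (nn_bias mn.1 + (e' + (M ^+ 2 / mn.2%:R) / e')))
      @[mn --> (\oo, \oo)] --> M * e'.
    have -> : M * e' = M * (0 + (0 + (e' + 0 / e'))) by rewrite mul0r addr0 !add0r.
    apply: cvgMr; apply: cvgD => //; apply: cvgD => //; apply: cvgD; first exact: cvg_cst.
    exact: cvgMl.
  apply: ler_cvg_to lhs rhs _; apply: filterS pos1 => -[m n] [/= m0 n0].
  exact: S_ge.
apply/cvgrPdist_lt => eps eps0.
(* The upper bound tends to [e + e], two thirds of [eps]. *)
pose e := eps / 3.
have e0 : 0 < e by rewrite divr_gt0.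
have up : (e + (M ^+ 2 / mn.2%:R + coincidence mn.1) / e) +
  (nn_bias mn.1 + (e + (M ^+ 2 / mn.2%:R) / e)) @[mn --> (\oo, \oo)] --> e + e.
  have -> : e + e = (e + (0 + 0) / e) + (0 + (e + 0 / e)).
    by rewrite addr0 !mul0r !addr0 add0r.
  apply: cvgD; last apply: cvgD => //.
    by apply: cvgD; [exact: cvg_cst|apply: cvgMl; apply: cvgD => //; rewrite -lim0].
  by apply: cvgD; [exact: cvg_cst|exact: cvgMl].
have e2 : e + e < eps by rewrite /e; lra.
near=> mn.
have [m0 n0] : (0 < mn.1)%N /\ (0 < mn.2)%N by near: mn.
rewrite sub0r normrN ger0_norm; last exact: Rintegral_ge0.
apply: le_lt_trans (S_le m0 n0 e0 devM psiM) _.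
by near: mn; exact: cvgr_lt up _ e2.
Unshelve. all: by end_near. Qed.

End model.

(** * From expectations to integrals of bounded functions *)

Theorem proposition4p4 (R : realType) (d e : nat)
  (hd : (0 < d)%N) (he : (0 < e)%N)
  (N : 'rV[R]_d -> R) (hN : is_norm N)
  (dTh : measure_display) (Th : measurableType dTh)
  (f : 'rV[R]_d * Th -> 'rV[R]_e) (hf : measurable_fun setT f)
  (phi : 'rV[R]_e -> R) (hphi : measurable_fun setT phi)
  (muX muX' : probability 'rV[R]_d R) (muTh : probability Th R)
  (dO : measure_display) (Omega : measurableType dO) (P : probability Omega R)
  (* X ~ muX and Theta ~ muTh, independent *)
  (X : {RV P >-> 'rV[R]_d}) (Theta : {RV P >-> Th})
  (hX : has_law X muX) (hTheta : has_law Theta muTh)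
  (hXTheta : independent_systems P
     (fun k : 'I_2 => nth set0 [:: sigma_rv X; sigma_rv Theta] k))
  (* the three independent i.i.d. sequences *)
  (Xs Xs' : nat -> {RV P >-> 'rV[R]_d}) (Thetas : nat -> {RV P >-> Th})
  (hXs : iid Xs muX) (hXs' : iid Xs' muX') (hThetas : iid Thetas muTh)
  (hindep : independent_systems P
     (fun k : 'I_3 => nth set0
        [:: sigma_seq (fun i => Xs i : Omega -> 'rV[R]_d);
            sigma_seq (fun j => Xs' j : Omega -> 'rV[R]_d);
            sigma_seq (fun j => Thetas j : Omega -> Th)] k)) :
  let QI : R := fine ('E_P[fun w => phi (f (X w, Theta w))])%E in
  let QIhat (m n : nat) (w : Omega) : R :=
    nn_estimator N m n (fun i => Xs i w) (fun j => Xs' j w)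
      (fun j => phi (f (Xs' j w, Thetas j w))) in
  let psi (x : 'rV[R]_d) : R := fine ('E_P[fun w => phi (f (x, Theta w))])%E in
  let vartheta (x : 'rV[R]_d) : R :=
    fine ('V_P[fun w => phi (f (x, Theta w))])%E in
  bounded_fun phi ->
  lipschitz_wrt N psi ->
  continuous vartheta ->
  supp N muX `<=` supp N muX' ->
  (* the first point is the initial value of the minimum over j < m0 *)
  (exists m0 : nat, (1 <= m0)%N /\
     ('E_P[fun w => \big[Order.min/N (Xs' 0%N w)]_(j < m0) N (Xs' j w)]
        < +oo)%E) ->
  (exists q : R, 1 <= q /\ ('E_P[fun w => (N (X w) `^ q)%R] < +oo)%E) ->
  (('E_P[fun w => `|QIhat mn.1 mn.2 w - QI|%R])%E @[mn --> (\oo, \oo)] --> 0%E)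
  <->
  (forall x, atoms muX x -> vartheta x = 0).
Proof.
move=> QI QIhat psi vartheta phi_bnd Lpsi cvth hsupp _ _.
pose g z := phi (f z).
have bg : bmeas g.
  split; first exact: measurableT_comp.
  (* [bounded_fun] makes every real above [M] a bound, in particular [M + 1]. *)
  have [M [_ /(_ (M + 1))]] := phi_bnd; rewrite ltrDl ltr01 => /(_ isT) phiM.
  by exists (M + 1) => z; exact: phiM.
have bgx x : bmeas (fun t => g (x, t)) by exact: bmeas_comp bg (pair1_measurable x).
have psiE : psi = fiber_mean muTh g.
  by apply/funext => x; rewrite /psi expectation.unlock /fiber_mean (Rint_law hTheta).
have varE : vartheta = fiber_var muTh g.
  apply/funext => x; rewrite /vartheta /variance covariance.unlock expectation.unlock.
  have bdx : bmeas (fun t => fiber_dev muTh g (x, t)).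
    exact: bmeas_comp (bmeas_fiber_dev muTh bg) (pair1_measurable x).
  rewrite /fiber_var (Rint_law hTheta); last exact: bmeasM.
  by rewrite /fiber_dev/= -psiE /psi expectation.unlock.
(* By independence of [X] and [Theta], averaging over [Theta] first writes QI as the mean of psi
   under [muX]. *)
have QIE : QI = \int[muX]_x fiber_mean muTh g x.
  rewrite /QI expectation.unlock (Rint_law hX (bmeas_fiber_mean muTh bg)).
  apply: (freezing1 (Z := X) (W := Theta) _ bg) => A B mA mB.
  rewrite -(hTheta B mB).
  apply: (independent_systems2 hXTheta (i := inord 0) (j := inord 1)).
  - by rewrite -val_eqE /= !inordK.
  - by rewrite inordK//; exact: sigma_rv_preimage.
  - by rewrite inordK//; exact: sigma_rv_preimage.
rewrite psiE in Lpsi; rewrite varE in cvth *.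
rewrite -(nn_mean_cvg_L1 hd hN bg hXs hXs' hThetas hindep Lpsi cvth hsupp) -QIE.
have QIhatE m n w : (0 < m)%N -> QIhat m n w = n%:R^-1 * \sum_(i < n)
    g (Xs' (nn_index N m (Xs'^~ w) (Xs i w)) w,
       Thetas (nn_index N m (Xs'^~ w) (Xs i w)) w).
  by move=> m0; rewrite /QIhat nn_estimatorE.
(* The rewritten form of the estimator is available for [0 < m], which holds eventually along the
   product filter. *)
have fst_gt0 : \forall mn \near (\oo, \oo), (0 < mn.1)%N.
  by exists ([set m | (0 < m)%N], setT) => [|mn []//]; split; [exists 1%N|exact: filterT].
(* Convergence of extended reals to 0 amounts to eventual finiteness and convergence of the real
   parts; finiteness comes from boundedness. *)
rewrite expectation.unlock; split => [/fine_cvgP[_ S0]|S0].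
  apply: cvg_trans S0; apply: near_eq_cvg; apply: filterS fst_gt0 => mn m0 /=.
  by rewrite /Rintegral; congr fine; apply: eq_integral => w _; rewrite QIhatE.
apply/fine_cvgP; split.
  apply: filterS fst_gt0 => mn m0.
  under eq_integral do rewrite QIhatE//.
  rewrite bmeas_integralE//; apply: bmeas_norm; apply: bmeasB; last exact: bmeas_cst.
  exact: (bmeas_est hN bg Xs Xs' Thetas).
apply: cvg_trans S0; apply: near_eq_cvg; apply: filterS fst_gt0 => mn m0 /=.
by rewrite /Rintegral; congr fine; apply: eq_integral => w _; rewrite QIhatE.
Qed.
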